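(* Let $X$ be a thick locally finite building of finite rank and type $(W,S)$, and let $G<\mathrm{Aut}(X)$ be a closed type-preserving subgroup acting Weyl-transitively. Let $\pi\colon G\to\mathcal U(\mathcal H)$ be a unitary representation. Then at least one of the following assertions holds. (i) $\pi$ is mixing. (ii) There is a minimal non-spherical subset $J\subset S$ such that $\pi|_{P_J}$ is amenable in the sense of Bekka.
   Context: Buildings. $(W,S)$ is a Coxeter system with word length $\ell$. A building $X$ of type $(W,S)$ is a set $\mathrm{Ch}(X)$ of chambers with a Weyl distance $\delta\colon \mathrm{Ch}(X)\times\mathrm{Ch}(X)\to W$ such that: $\delta(C,D)=e$ iff $C=D$; if $\delta(C,D)=w$ and $\delta(C',C)=s\in S$ then $\delta(C',D)\in\{sw,w\}$, with $\delta(C',D)=sw$ if $\ell(sw)=\ell(w)+1$; and if $\delta(C,D)=w$ then for each $s\in S$ there is $C'$ with $\delta(C',C)=s$ and $\delta(C',D)=sw$. For $J\subset S$ let $W_J=\langle J\rangle$; the $J$-residue of a chamber $C$ is $\{D:\delta(C,D)\in W_J\}$; an $s$-panel is an $\{s\}$-residue. $X$ has finite rank if $S$ is finite, is thick if every panel has at least $3$ chambers, and is locally finite if every panel is finite. $\mathrm{Aut}(X)$ carries the topology of pointwise convergence on chambers. A type-preserving subgroup $G$ (one preserving $\delta$) acts Weyl-transitively if for each $w\in W$ it is transitive on ordered pairs of chambers $(C,D)$ with $\delta(C,D)=w$. Fix a base chamber $c_0$. For $J\subset S$, $P_J$ is the stabilizer in $G$ of the $J$-residue containing $c_0$. A subset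 $J\subset S$ is spherical if $W_J$ is finite, and minimal non-spherical if $W_J$ is infinite while $W_I$ is finite for every proper subset $I\subsetneq J$. Unitary representations are strongly continuous. $\pi$ is mixing if for all $\xi,\eta\in\mathcal H$ the function $g\mapsto\langle\pi(g)\xi,\eta\rangle$ lies in $C_0(G)$ (vanishes at infinity). A unitary representation $\rho$ of a locally compact group $H$ is amenable in the sense of Bekka if $\mathbf 1_H\prec\rho\otimes\overline\rho$, where $\prec$ denotes weak containment, $\mathbf 1_H$ the trivial representation, and $\overline\rho$ the conjugate representation. *)

(* Defs.v *)
From HB Require Import structures.
From mathcomp Require Import all_boot all_order all_algebra.
From mathcomp Require Import complex.
From mathcomp Require Import all_classical all_reals all_analysis.

Set Implicit Arguments.
Unset Strict Implicit.
Unset Printing Implicit Defensive.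

Import Order.TTheory GRing.Theory Num.Theory Num.Def.
Import numFieldNormedType.Exports.

Local Open Scope classical_set_scope.
Local Open Scope ring_scope.
Local Open Scope complex_scope.

Definition subgroup (A : groupType) (G : set A) : Prop :=
  [/\ G 1%g, (forall g h, G g -> G h -> G (g * h)%g) &
      (forall g, G g -> G g^-1%g)].

Definition generated (A : groupType) (E : set A) : set A :=
  smallest (@subgroup A) E.

(* [W] is the group presented by the generators [S] and the relations
   (s t)^m(s,t) = 1, m(s,t) the order of s t, expressed by the universal
   property of the presentation; s = t, n = 1 gives s^2 = 1.  (Uniqueness of
   the extension follows from generation.) *)
Definition coxeter_system (W : groupType) (S : set W) : Prop :=
  [/\ (forall s, S s -> s <> 1%g /\ (s * s)%g = 1%g),
      generated S = setT &
      forall (K : groupType) (f : W -> K),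
        (forall s t n, S s -> S t -> ((s * t) ^+ n)%g = 1%g ->
          ((f s * f t) ^+ n)%g = 1%g) ->
        exists F : W -> K,
          {morph F : x y / (x * y)%g} /\ forall s, S s -> F s = f s].

Definition is_word (W : groupType) (S : set W) (w : W) (n : nat) : Prop :=
  exists u : seq W, [/\ size u = n, (forall s, s \in u -> S s) &
                        w = (\prod_(s <- u) s)%g].

(* The value for an element that is not a product of elements of [S] (there
   are none in a Coxeter system) is 0. *)
Definition word_length (W : groupType) (S : set W) (w : W) : nat :=
  if pselect (exists n, `[< is_word S w n >]) is left ex then ex_minn ex else 0%N.

Record building (W : groupType) (S : set W) := Building {
  chamber :> choiceType;
  wdist : chamber -> chamber -> W;
  wdist_eq1 : forall C D, wdist C D = 1%g <-> C = D;
  wdist_adj : forall C D C' s, S s -> wdist C' C = s ->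
    wdist C' D = (s * wdist C D)%g \/ wdist C' D = wdist C D;
  wdist_adj_up : forall C D C' s, S s -> wdist C' C = s ->
    word_length S (s * wdist C D)%g = (word_length S (wdist C D)).+1 ->
    wdist C' D = (s * wdist C D)%g;
  wdist_ex : forall C D s, S s ->
    exists C', wdist C' C = s /\ wdist C' D = (s * wdist C D)%g }.

Section Buildings.
Context {W : groupType} {S : set W} (X : building S).

Definition residue (J : set W) (C : X) : set X :=
  [set D | generated J (wdist C D)].

Definition panel (s : W) (C : X) : set X := residue [set s] C.

Definition thick : Prop := forall s C, S s -> (`I_3 #<= panel s C)%card.

Definition locally_finite : Prop := forall s C, S s -> finite_set (panel s C).

(* An automorphism of [X] may permute the types, by an automorphism of the
   Coxeter system. *)
Definition is_autom (g : X -> X) : Prop :=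
  bijective g /\
  exists f : W -> W, [/\ bijective f, {morph f : x y / (x * y)%g}, f @` S = S &
    forall C D, wdist (g C) (g D) = f (wdist C D)].

Record autom := Autom { autom_fun :> X -> X; automP : is_autom autom_fun }.

HB.instance Definition _ := gen_eqMixin autom.
HB.instance Definition _ := gen_choiceMixin autom.

Lemma autom_ext (g h : autom) : autom_fun g =1 autom_fun h -> g = h.
Proof.
case: g h => [g gP] [h hP] /= /funext gh; rewrite -gh in hP *.
by rewrite (Prop_irrelevance gP hP).
Qed.

Lemma is_autom_id : is_autom id.
Proof.
split; first by exists id.
by exists id; split => //; [exists id | rewrite image_id].
Qed.

Lemma is_autom_comp g h : is_autom g -> is_autom h -> is_autom (g \o h).
Proof.
move=> [gb [f [fb fM fS fd]]] [hb [k [kb kM kS kd]]]; split; first exact: bij_comp.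
exists (f \o k); split.
- exact: bij_comp.
- by move=> x y /=; rewrite kM fM.
- by rewrite -[in RHS]fS -[in RHS]kS image_comp.
- by move=> C D /=; rewrite fd kd.
Qed.

Lemma is_autom_inv g h : cancel g h -> cancel h g -> is_autom g -> is_autom h.
Proof.
move=> gh hg [_ [f [[k fk kf] fM fS fd]]]; split; first by exists g.
exists k; split.
- by exists f.
- by move=> x y; apply: (can_inj fk); rewrite fM !kf.
- by rewrite -[in LHS]fS image_comp (_ : k \o f = id) ?image_id//; apply/funext.
- by move=> C D; apply: (can_inj fk); rewrite kf -fd !hg.
Qed.

Definition autom1 := Autom is_autom_id.
Definition autom_mul (g h : autom) := Autom (is_autom_comp (automP g) (automP h)).

Lemma autom_inv_subproof (g : autom) :
  {h : autom | cancel g h & cancel h g}.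
Proof.
apply: cid2; case: (automP g) => -[h gh hg] _.
by exists (Autom (is_autom_inv gh hg (automP g))).
Qed.

Definition autom_inv (g : autom) : autom := s2val (autom_inv_subproof g).

Fact autom_mulA : associative autom_mul.
Proof. by move=> f g h; apply: autom_ext. Qed.
Fact autom_mul1g : left_id autom1 autom_mul.
Proof. by move=> g; apply: autom_ext. Qed.
Fact autom_mulg1 : right_id autom1 autom_mul.
Proof. by move=> g; apply: autom_ext. Qed.
Fact autom_mulVg : left_inverse autom1 autom_inv autom_mul.
Proof.
by move=> g; apply: autom_ext => C /=; rewrite /autom_inv; case: autom_inv_subproof.
Qed.
Fact autom_mulgV : right_inverse autom1 autom_inv autom_mul.
Proof.
by move=> g; apply: autom_ext => C /=; rewrite /autom_inv; case: autom_inv_subproof.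
Qed.

HB.instance Definition _ := isGroup.Build autom
  autom_mulA autom_mul1g autom_mulg1 autom_mulVg autom_mulgV.

HB.instance Definition _ := Topological.copy autom
  (initial_topology
    (fun g : autom => (g : X -> X) : {ptws X -> discrete_topology X})).

Definition type_preserving (G : set autom) : Prop :=
  forall g, G g -> forall C D, wdist (g C) (g D) = wdist C D.

Definition weyl_transitive (G : set autom) : Prop :=
  forall (w : W) (C D C' D' : X), wdist C D = w -> wdist C' D' = w ->
    exists g : autom, [/\ G g, g C = C' & g D = D'].

Definition parabolic (G : set autom) (c0 : X) (J : set W) : set autom :=
  [set g | G g /\ g @` residue J c0 = residue J c0].

End Buildings.

Definition spherical (W : groupType) (J : set W) : Prop :=
  finite_set (generated J).

Definition minimal_non_spherical (W : groupType) (S J : set W) : Prop :=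
  [/\ J `<=` S, ~ spherical J & forall I, I `<` J -> spherical I].

HB.mixin Record hasInner (R : realType) H & CompleteNormedModule R[i] H := {
  inner : {dot H for @conjC R[i]};
  inner_norm : forall x : H, inner x x = `|x| ^+ 2
}.

#[short(type="hilbertType")]
HB.structure Definition Hilbert (R : realType) :=
  { H of CompleteNormedModule R[i] H & hasInner R H }.


Section HilbertSpaces.
Context {R : realType}.
Local Notation C := R[i].

Lemma normc_Re_le (z : C) : `|complex.Re z|%:C <= `|z|.
Proof. by case: z => a b; rewrite normc_def lecR /= -sqrtr_sqr ler_wsqrtr ?lerDl ?sqr_ge0. Qed.

Lemma normc_Im_le (z : C) : `|complex.Im z|%:C <= `|z|.
Proof. by case: z => a b; rewrite normc_def lecR /= -sqrtr_sqr ler_wsqrtr ?lerDr ?sqr_ge0. Qed.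

Lemma normc_le_add (z : C) : `|z| <= (`|complex.Re z| + `|complex.Im z|)%:C.
Proof.
case: z => a b /=; rewrite (_ : a +i* b = a%:C + 0 +i* b); last by simpc.
apply: le_trans (ler_normD _ _) _.
by rewrite !normc_def /= !expr0n/= addr0 add0r !sqrtr_sqr rmorphD.
Qed.

(* An alias of C^o, on which the canonical complete-space instance is already
   the one for real scalars. *)
Definition scalar_space : Type := C^o.

HB.instance Definition _ := NormedModule.copy scalar_space C^o.

Lemma scalar_space_complete (F : set_system scalar_space) :
  ProperFilter F -> cauchy F -> cvg F.
Proof.
move=> FF /cauchy_ballP F_cauchy.
have cvg_part (p : C -> R) : (forall x y, p (x - y) = p x - p y) ->
    (forall z, `|p z|%:C <= `|z|) -> cvg (p x @[x --> F]).
  move=> pB p_le; apply: R_complete; apply/cauchy_ballP => e e0.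
  have e0C : 0 < e%:C by rewrite ltcR.
  have := F_cauchy _ e0C; rewrite !near_simpl => -[[A B] /= [FA FB] AB].
  exists (p @` A, p @` B) => /=.
    by split; [apply: filterS FA | apply: filterS FB] => x ?; exists x.
  move=> [_ _] /= [[x Ax <-] [y By <-]].
  have := AB (x, y) (conj Ax By); rewrite /= -!ball_normE /= => xye.
  by rewrite -ltcR -pB; apply: le_lt_trans (p_le _) xye.
have /cvg_ex[a Fa] : cvg (complex.Re x @[x --> F]).
  by apply: cvg_part normc_Re_le => -[? ?] [? ?].
have /cvg_ex[b Fb] : cvg (complex.Im x @[x --> F]).
  by apply: cvg_part normc_Im_le => -[? ?] [? ?].
apply/cvg_ex; exists (a +i* b : scalar_space).
apply/fcvgrPdist_lt => -[e f]; rewrite ltcE /= => /andP[/eqP f0 e0].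
rewrite f0; near=> z; apply: le_lt_trans (normc_le_add _) _.
rewrite [X in _ < X](_ : _ = e%:C)// ltcR [e]splitr.
have -> : complex.Re (a +i* b - z) = a - complex.Re z by case: (z).
have -> : complex.Im (a +i* b - z) = b - complex.Im z by case: (z).
apply: ltrD.
  by near: z; apply: cvgr_dist_lt; [exact: Fa | rewrite divr_gt0].
by near: z; apply: cvgr_dist_lt; [exact: Fb | rewrite divr_gt0].
Unshelve. all: by end_near. Qed.

HB.instance Definition _ := Uniform_isComplete.Build scalar_space scalar_space_complete.

Definition scalar_inner (x y : scalar_space) : C := x * conjC (y : C).

Fact scalar_inner_bilinear :
  bilinear_for *%R (conjC \; *%R) scalar_inner.
Proof.
split=> [y a x z | x a y z]; rewrite /scalar_inner /=.
  by rewrite mulrDl -mulrA.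
by rewrite rmorphD rmorphM /= mulrDr mulrCA.
Qed.
HB.instance Definition _ := @bilinear_isBilinear.Build _ _ _ _ _ _ _
  scalar_inner_bilinear.

Fact scalar_inner_herm (x y : scalar_space) :
  scalar_inner x y = (-1) ^+ false * conjC (scalar_inner y x).
Proof. by rewrite expr0 mul1r /scalar_inner rmorphM /= conjCK mulrC. Qed.
HB.instance Definition _ :=
  isHermitianSesquilinear.Build _ _ _ _ scalar_inner scalar_inner_herm.

Fact scalar_inner_gt0 (x : scalar_space) : x != 0 -> 0 < scalar_inner x x.
Proof. by move=> x0; rewrite /scalar_inner mul_conjC_gt0. Qed.
HB.instance Definition _ := isDotProduct.Build _ _ scalar_inner scalar_inner_gt0.

Fact scalar_inner_norm (x : scalar_space) : scalar_inner x x = `|x| ^+ 2.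
Proof. by rewrite /scalar_inner -normCK. Qed.
HB.instance Definition _ := hasInner.Build R scalar_space scalar_inner_norm.

End HilbertSpaces.

(* The conjugate Hilbert space: the same vectors, norm and topology, with
   scalar multiplication (a, x) |-> a^* x and the conjugate inner product. *)
Definition conj_space (R : realType) (H : hilbertType R) : Type := H.

Section ConjugateSpace.
Context {R : realType} (H : hilbertType R).
Local Notation C := R[i].
Local Notation Hc := (conj_space H).

HB.instance Definition _ := PseudoMetricNormedZmod.copy Hc H.
HB.instance Definition _ := Complete.copy Hc H.

Definition conj_scale (a : C) (x : Hc) : Hc := conjC a *: (x : H).

Fact conj_scaleA a b (x : Hc) :
  conj_scale a (conj_scale b x) = conj_scale (a * b) x.
Proof. by rewrite /conj_scale scalerA rmorphM. Qed.
Fact conj_scale1 : left_id 1 conj_scale.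
Proof. by move=> x; rewrite /conj_scale rmorph1 scale1r. Qed.
Fact conj_scaleDr : right_distributive conj_scale +%R.
Proof. by move=> a x y; rewrite /conj_scale scalerDr. Qed.
Fact conj_scaleDl (x : Hc) : {morph conj_scale^~ x : a b / a + b}.
Proof. by move=> a b; rewrite /conj_scale rmorphD scalerDl. Qed.
HB.instance Definition _ := GRing.Zmodule_isLmodule.Build C Hc
  conj_scaleA conj_scale1 conj_scaleDr conj_scaleDl.

Fact conj_normrZ (a : C) (x : Hc) : `|a *: x| = `|a| * `|x|.
Proof.
by rewrite -[LHS]/(`|conjC a *: (x : H)|) normrZ norm_conjC.
Qed.
HB.instance Definition _ :=
  PseudoMetricNormedZmod_Lmodule_isNormedModule.Build C Hc conj_normrZ.

Definition conj_inner (x y : Hc) : C := inner (y : H) (x : H).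

Fact conj_inner_bilinear : bilinear_for *%R (conjC \; *%R) conj_inner.
Proof.
split=> [y a x z | x a y z]; rewrite /conj_inner /=.
  by rewrite linearDr linearZr_LR /= conjCK.
by rewrite linearDl linearZl_LR.
Qed.
HB.instance Definition _ := @bilinear_isBilinear.Build _ _ _ _ _ _ _
  conj_inner_bilinear.

Fact conj_inner_herm (x y : Hc) :
  conj_inner x y = (-1) ^+ false * conjC (conj_inner y x).
Proof. exact: hermC. Qed.
HB.instance Definition _ :=
  isHermitianSesquilinear.Build _ _ _ _ conj_inner conj_inner_herm.

Fact conj_inner_gt0 (x : Hc) : x != 0 -> 0 < conj_inner x x.
Proof. exact: (@neq0_dnorm_gt0 _ _ _ inner (x : H)). Qed.
HB.instance Definition _ := isDotProduct.Build _ _ conj_inner conj_inner_gt0.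

Fact conj_inner_norm (x : Hc) : conj_inner x x = `|x| ^+ 2.
Proof. exact: (inner_norm (x : H)). Qed.
HB.instance Definition _ := hasInner.Build R Hc conj_inner_norm.

End ConjugateSpace.

(* [T], with [t x y] as the vector x (x) y, is the Hilbert space tensor product
   of [H] and [K].  Such a [T] exists, and is unique up to a unique unitary
   isomorphism compatible with [t]. *)
Definition hilbert_tensor (R : realType) (H K T : hilbertType R)
    (t : {bilinear H -> K -> T}) : Prop :=
  (forall x y x' y', inner (t x y) (t x' y') = inner x x' * inner y y') /\
  closure [set \sum_(p <- s) t p.1 p.2 | s in [set: seq (H * K)]] = setT.

(* No compatibility between the two structures is imposed. *)
#[short(type="preTopologicalGroupType")]
HB.structure Definition PreTopologicalGroup := { A of Group A & Topological A }.
HB.instance Definition _ (W : groupType) (S : set W) (X : building S) :=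
  Topological.on (autom X).

Definition unitary (R : realType) (H : hilbertType R) (U : H -> H) : Prop :=
  [/\ linear U, (forall y, exists x, U x = y) &
      forall x y, inner (U x) (U y) = inner x y].

(* Representations of a subgroup [G] of a topological group [A], carrying the
   induced topology, are given by functions on [A] whose values outside [G] are
   irrelevant; restricting a representation to a subgroup of [G] leaves the
   function unchanged. *)
Section Representations.
Context {R : realType} {A : preTopologicalGroupType} (G : set A).

Definition unitary_rep (H : hilbertType R) (rho : A -> H -> H) : Prop :=
  [/\ forall g, G g -> unitary (rho g),
      forall g h, G g -> G h -> rho (g * h)%g =1 rho g \o rho h &
      forall x, {within G, continuous (fun g => rho g x)}].

Definition vanishes_at_infinity (f : A -> R[i]) : Prop :=
  forall e : R[i], 0 < e -> exists K : set A,
    [/\ K `<=` G, compact K & forall g, G g -> ~ K g -> `|f g| < e].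

Definition mixing (H : hilbertType R) (rho : A -> H -> H) : Prop :=
  forall x y, vanishes_at_infinity (fun g => inner (rho g x) y).

(* Each diagonal coefficient of [rho] is a limit, uniformly on compact subsets
   of [G], of finite sums of diagonal coefficients of [sigma]. *)
Definition weakly_contained (H K : hilbertType R)
    (rho : A -> H -> H) (sigma : A -> K -> K) : Prop :=
  forall (x : H) (Q : set A) (e : R[i]), Q `<=` G -> compact Q -> 0 < e ->
    exists s : seq K, forall g, Q g ->
      `|inner (rho g x) x - \sum_(y <- s) inner (sigma g y) y| < e.

Definition trivial_rep (g : A) (z : @scalar_space R) : @scalar_space R := z.

Definition conj_rep (H : hilbertType R) (rho : A -> H -> H) (g : A)
  (x : conj_space H) : conj_space H := rho g x.

Definition tensor_rep (H K T : hilbertType R) (t : {bilinear H -> K -> T})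
    (rho : A -> H -> H) (sigma : A -> K -> K) (tau : A -> T -> T) : Prop :=
  [/\ hilbert_tensor t, unitary_rep tau &
      forall g x y, G g -> tau g (t x y) = t (rho g x) (sigma g y)].

Definition bekka_amenable (H : hilbertType R) (rho : A -> H -> H) : Prop :=
  exists (T : hilbertType R) (t : {bilinear H -> conj_space H -> T})
         (tau : A -> T -> T),
    tensor_rep t rho (conj_rep rho) tau /\ weakly_contained trivial_rep tau.

End Representations.

(* Main.v *)
(* Let [sigma] be the tensor product of [rho] and its conjugate on the Hilbert
   space [T], and [B] the stabilizer of [c0].  For a [B]-invariant vector [v] of
   [T] the vectors [v_c = sigma g v], [c = g c0], form an equivariant field on
   the chambers.  Averaging this field over the chambers that are [s]-adjacent
   to [c0] gives a contraction [T_s] of the [B]-invariant vectors, and for a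
   reduced word [s_1 ... s_n] the coefficient <v_c, v'> at a chamber [c] with
   [delta(c, c0) = s_1 ... s_n] is <T_{s_n} ... T_{s_1} v, v'>.
   Thickness makes the defect [|v|^2 - |T_s v|^2] control [|v_d - v|] for [d]
   adjacent to [c0] by [s]; so a vector that a word almost does not contract is
   almost invariant under all letters of the word.  A reduced word that is long
   enough has a non-spherical set of letters, which contains a minimal
   non-spherical [J].  If no [rho|P_J] is amenable, then no nonzero
   [B]-invariant vector is almost invariant under [P_J], hence words of some
   fixed length [N] contract uniformly and <sigma g v, v'> decays.  Applied to
   the [B]-invariant vectors of minimal norm in the closed convex hulls of the
   orbits of [xi (x) xi^*] and [eta (x) eta^*], this makes <rho g xi, eta>
   vanish at infinity: compactness of [B] bounds |<rho g xi, eta>|^2 by a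
   multiple of <sigma g v, v'>, up to a small error. *)

Require Import Defs.
From HB Require Import structures.
From mathcomp Require Import all_boot all_order all_algebra.
From mathcomp Require Import complex.
From mathcomp Require Import all_classical all_reals all_analysis.
From mathcomp Require Import finmap lra ring zify.

Set Implicit Arguments.
Unset Strict Implicit.
Unset Printing Implicit Defensive.

Import Order.TTheory GRing.Theory Num.Theory Num.Def.
Import numFieldNormedType.Exports.

Local Open Scope classical_set_scope.
Local Open Scope ring_scope.
Local Open Scope complex_scope.

(** * Real-valued norms and inner products *)

Section RealModulus.
Context {R : realType}.
Local Notation C := R[i].

Lemma ReD (x y : C) : complex.Re (x + y) = complex.Re x + complex.Re y.
Proof. by case: x => ? ?; case: y. Qed.

Lemma ReN (x : C) : complex.Re (- x) = - complex.Re x.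
Proof. by case: x. Qed.

Lemma ReB (x y : C) : complex.Re (x - y) = complex.Re x - complex.Re y.
Proof. by rewrite ReD ReN. Qed.

Lemma ReZ (a : R) (y : C) : complex.Re (a%:C * y) = a * complex.Re y.
Proof. by case: y => ? ? /=; rewrite mul0r subr0. Qed.

Lemma conjC_real (a : R) : conjC a%:C = a%:C :> C.
Proof. exact: conjc_real. Qed.

Lemma conjCZ (a : R) (z : C) : conjC (a%:C * z) = a%:C * conjC z.
Proof. by rewrite rmorphM; congr (_ * _); exact: conjC_real. Qed.

Lemma conjCM (x y : C) : conjC (x * y) = conjC x * conjC y.
Proof. exact: rmorphM. Qed.

Lemma conjCD (x y : C) : conjC (x + y) = conjC x + conjC y.
Proof. exact: rmorphD. Qed.

Lemma conjC_sum I (s : seq I) (F : I -> C) :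
  conjC (\sum_(i <- s) F i) = \sum_(i <- s) conjC (F i).
Proof. exact: rmorph_sum. Qed.

Lemma Re_conjC (x : C) : complex.Re (conjC x) = complex.Re x.
Proof. by case: x. Qed.

Lemma Re_sum I (s : seq I) (F : I -> C) :
  complex.Re (\sum_(i <- s) F i) = \sum_(i <- s) complex.Re (F i).
Proof.
by elim: s => [|i s IH]; rewrite ?big_nil// !big_cons ReD IH.
Qed.

Lemma ge0_ReK (x : C) : 0 <= x -> (complex.Re x)%:C = x.
Proof. by move=> x0; apply/RRe_real/ger0_real. Qed.

Lemma ge0_Re (x : C) : 0 <= x -> 0 <= complex.Re x.
Proof. by rewrite lecE => /andP[]. Qed.

Section Modulus.
Context {E : normedZmodType C}.
Implicit Types x y z : E.

(* The norms of the library are [R[i]]-valued here; [nr] takes values in the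
   totally ordered field [R]. *)
Definition nr (x : E) : R := complex.Re `|x|.

Lemma nrE x : `|x| = (nr x)%:C.
Proof. by rewrite ge0_ReK. Qed.

Lemma nr_ge0 x : 0 <= nr x.
Proof. exact: ge0_Re. Qed.

Lemma nrD x y : nr (x + y) <= nr x + nr y.
Proof. by rewrite -lecR -nrE rmorphD /= -!nrE ler_normD. Qed.

Lemma nrC x y : nr (x - y) = nr (y - x).
Proof. by rewrite /nr distrC. Qed.

Lemma nr0 : nr (0 : E) = 0.
Proof. by rewrite /nr normr0. Qed.

Lemma nr0_eq0 x : nr x = 0 -> x = 0.
Proof. by move=> x0; apply/normr0_eq0; rewrite nrE x0. Qed.

Lemma nr_tri z x y : nr (x - y) <= nr (x - z) + nr (z - y).
Proof. by apply: le_trans (nrD _ _); rewrite addrA subrK. Qed.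

Lemma nr_tri2 x y : nr x <= nr y + nr (x - y).
Proof. by apply: le_trans (nrD _ _); rewrite addrC subrK. Qed.

Lemma nr_distl z x y (e1 e2 : R) :
  nr (z - x) < e1 -> nr (z - y) <= e2 -> nr (x - y) < e1 + e2.
Proof.
by move=> h1 h2; apply: le_lt_trans (nr_tri z _ _) _; rewrite nrC ltr_leD.
Qed.

Lemma nr_distr z x y (e1 e2 : R) :
  nr (x - z) < e1 -> nr (y - z) <= e2 -> nr (x - y) < e1 + e2.
Proof. by rewrite nrC (nrC y); exact: nr_distl. Qed.

End Modulus.

Lemma nrM (x y : C) : nr (x * y) = nr x * nr y.
Proof. by apply: complexI; rewrite -nrE normrM !nrE -rmorphM. Qed.

Lemma nr_conj (x : C) : nr (conjC x) = nr x.
Proof. by rewrite /nr norm_conjC. Qed.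

Lemma nrZ (E : normedModType C) (a : C) (x : E) : nr (a *: x) = nr a * nr x.
Proof. by apply: complexI; rewrite -nrE normrZ !nrE -rmorphM. Qed.

Lemma nr_real (a : R) : nr (a%:C : C) = `|a|.
Proof. by rewrite /nr normc_def /= expr0n addr0 sqrtr_sqr. Qed.

Lemma Re_le_nr (x : C) : `|complex.Re x| <= nr x.
Proof. by rewrite -lecR -nrE normc_ge_Re. Qed.

Lemma sqr_nr (x : C) : ((nr x) ^+ 2)%:C = x * conjC x.
Proof. by rewrite rmorphXn /= -nrE normCK. Qed.

Lemma cvg_nrP (E : normedModType C) T (F : set_system T) {FF : Filter F}
    (f : T -> E) (l : E) :
  f @ F --> l <-> forall e : R, 0 < e -> \forall t \near F, nr (f t - l) < e.
Proof.
split=> [/cvgrPdist_lt fl e e0|fl].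
  have := fl e%:C; rewrite ltcR => /(_ e0); apply: filterS => t.
  by rewrite nrE ltcR nrC.
apply/cvgrPdist_lt => e e0; have eE := ge0_ReK (ltW e0).
have /fl : 0 < complex.Re e by rewrite -ltcR eE.
by apply: filterS => t; rewrite -ltcR eE -nrE distrC.
Qed.

Lemma cvg_seqP (E : normedModType C) (f : nat -> E) (l : E) :
  f n @[n --> \oo] --> l <->
  forall e : R, 0 < e -> exists N, forall n, (N <= n)%N -> nr (f n - l) < e.
Proof.
split=> [/cvg_nrP fl e /fl [N _ NP]|fl]; first by exists N.
by apply/cvg_nrP => e /fl[N NP]; exists N.
Qed.

Lemma cvg_conjC T (F : set_system T) {FF : Filter F} (f : T -> C^o) (l : C^o) :
  f @ F --> l -> (conjC (f t) : C^o) @[t --> F] --> (conjC l : C^o).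
Proof.
move=> /cvg_nrP fl; apply/cvg_nrP => e /fl; apply: filterS => t.
by rewrite -rmorphB nr_conj.
Qed.

Lemma cvg_Re T (F : set_system T) {FF : Filter F} (f : T -> C^o) (l : C^o) :
  f @ F --> l -> complex.Re (f t) @[t --> F] --> complex.Re l.
Proof.
move=> /cvg_nrP fl; apply/cvgrPdist_lt => e /fl; apply: filterS => t.
by apply: le_lt_trans; rewrite distrC -ReB Re_le_nr.
Qed.

End RealModulus.

(** * Semi-inner products and the Cauchy-Schwarz inequality *)

Section SemiInner.
Context {R : realType}.
Local Notation C := R[i].
Context {V : lmodType C} (q : {hermitian_sym V for @conjC C}).
Hypothesis q_ge0 : forall v, 0 <= q v v.

Lemma semi_hermC u v : q u v = conjC (q v u).
Proof. by rewrite [LHS]hermC expr0 mul1r. Qed.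

Lemma semiZl a u v : q (a *: u) v = a * q u v.
Proof. exact: linearZl_LR. Qed.

Lemma semiZr a u v : q u (a *: v) = conjC a * q u v.
Proof. exact: linearZr_LR. Qed.

Lemma semiDl u v w : q (u + v) w = q u w + q v w.
Proof. exact: linearDl. Qed.

Lemma semiDr u v w : q w (u + v) = q w u + q w v.
Proof. exact: linearDr. Qed.

Lemma semiBl u v w : q (u - v) w = q u w - q v w.
Proof. exact: linearBl. Qed.

Lemma semiBr u v w : q w (u - v) = q w u - q w v.
Proof. exact: linearBr. Qed.

Definition semi_norm (v : V) : R := Num.sqrt (complex.Re (q v v)).
Local Notation sn := semi_norm.

Lemma semi_norm_ge0 v : 0 <= sn v.
Proof. exact: sqrtr_ge0. Qed.

Lemma semi_norm_sqr v : q v v = ((sn v) ^+ 2)%:C.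
Proof. by rewrite sqr_sqrtr ?ge0_ReK// ge0_Re. Qed.

Lemma semi_norm_sqrE v : sn v ^+ 2 = complex.Re (q v v).
Proof. by rewrite semi_norm_sqr. Qed.

Lemma semi_normZ a v : sn (a *: v) = nr a * sn v.
Proof.
apply: (@pexpIrn _ 2) => //; rewrite ?nnegrE ?mulr_ge0 ?semi_norm_ge0 ?nr_ge0//.
apply: complexI; rewrite -semi_norm_sqr semiZl semiZr mulrA.
by rewrite -sqr_nr semi_norm_sqr -rmorphM exprMn.
Qed.

Lemma semi_normD_sqr u v :
  sn (u + v) ^+ 2 = sn u ^+ 2 + sn v ^+ 2 + 2 * complex.Re (q u v).
Proof.
rewrite !semi_norm_sqrE semiDl !semiDr !ReD.
have -> : complex.Re (q v u) = complex.Re (q u v) by rewrite semi_hermC Re_conjC.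
by ring.
Qed.

Lemma semi_CauchySchwarz u v : nr (q u v) <= sn u * sn v.
Proof.
pose n := nr (q u v) ^+ 2.
(* This is the squared length of [u - s <u, v> v] for real [s]; the optimal choice below is
   [s = 1 / |v|^2]. *)
have key (s : R) : 0 <= sn u ^+ 2 + s ^+ 2 * n * sn v ^+ 2 - 2 * s * n.
  have := sqr_ge0 (sn (u + ((- s)%:C * q u v) *: v)).
  rewrite semi_normD_sqr semi_normZ nrM nr_real.
  have -> : complex.Re (q u (((- s)%:C * q u v) *: v)) = - (s * n).
    rewrite semiZr conjCZ -mulrA ReZ mulrC (mulrC (conjC _)) -sqr_nr.
    by rewrite mulrC mulNr.
  by rewrite normrN !exprMn real_normK ?num_real// /n; lra.
have [v0|v0] := eqVneq (sn v) 0.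
  have [n0|n0] := eqVneq n 0.
    by rewrite v0 mulr0 le_eqVlt -sqrf_eq0 -/n n0 eqxx.
  (* A nonzero [v] may have length 0. The quadratic term then vanishes, and this [s] turns [key]
     into [0 <= -1]. *)
  have := key ((sn u ^+ 2 + 1) / (2 * n)); rewrite v0 expr0n mulr0 addr0.
  have -> : 2 * ((sn u ^+ 2 + 1) / (2 * n)) * n = sn u ^+ 2 + 1 by field.
  by lra.
have := key (sn v ^- 2).
have -> : sn u ^+ 2 + (sn v ^- 2) ^+ 2 * n * sn v ^+ 2 - 2 * sn v ^- 2 * n =
   (sn u ^+ 2 * sn v ^+ 2 - n) / sn v ^+ 2 by field.
have v2 : 0 < sn v ^+ 2 by rewrite exprn_gt0// lt_neqAle eq_sym v0 semi_norm_ge0.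
rewrite pmulr_lge0 ?invr_gt0// subr_ge0 -exprMn ler_pXn2r//.
  by rewrite nnegrE nr_ge0.
by rewrite nnegrE mulr_ge0 ?semi_norm_ge0.
Qed.

Lemma semi_normD u v : sn (u + v) <= sn u + sn v.
Proof.
have h := semi_CauchySchwarz u v.
rewrite -(@ler_pXn2r _ 2) ?nnegrE ?addr_ge0 ?semi_norm_ge0// semi_normD_sqr.
have := le_trans (ler_norm _) (Re_le_nr (q u v)); nra.
Qed.

End SemiInner.

Section Inner.
Context {R : realType} {H : hilbertType R}.
Local Notation C := R[i].
Implicit Types x y z : H.

Lemma innerC x y : inner x y = conjC (inner y x).
Proof. exact: (semi_hermC inner). Qed.

Lemma innerZl a x y : inner (a *: x) y = a * inner x y.
Proof. exact: (semiZl inner). Qed.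

Lemma innerDl x y z : inner (x + y) z = inner x z + inner y z.
Proof. exact: (semiDl inner). Qed.

Lemma innerDr x y z : inner z (x + y) = inner z x + inner z y.
Proof. exact: (semiDr inner). Qed.

Lemma innerBl x y z : inner (x - y) z = inner x z - inner y z.
Proof. exact: (semiBl inner). Qed.

Lemma innerBr x y z : inner z (x - y) = inner z x - inner z y.
Proof. exact: (semiBr inner). Qed.

Lemma inner0l y : inner 0 y = 0.
Proof. by rewrite -(scale0r (0 : H)) innerZl mul0r. Qed.

Lemma inner_suml I (s : seq I) (F : I -> H) y :
  inner (\sum_(i <- s) F i) y = \sum_(i <- s) inner (F i) y.
Proof.
by elim: s => [|i s IH]; rewrite ?big_nil ?inner0l// !big_cons innerDl IH.
Qed.

Lemma inner_ge0 x : 0 <= inner x x.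
Proof. by rewrite inner_norm exprn_ge0. Qed.

Lemma inner_eq0 x : (inner x x == 0) = (x == 0).
Proof. by rewrite inner_norm expf_eq0 /= normr_eq0. Qed.

Lemma inner_nr x : inner x x = (nr x ^+ 2)%:C.
Proof. by rewrite inner_norm nrE rmorphXn. Qed.

Lemma semi_norm_inner x : semi_norm inner x = nr x.
Proof. by rewrite /semi_norm /= inner_nr sqrtr_sqr ger0_norm// nr_ge0. Qed.

Lemma inner_CauchySchwarz x y : nr (inner x y) <= nr x * nr y.
Proof. by rewrite -!semi_norm_inner; exact: (semi_CauchySchwarz inner_ge0). Qed.

End Inner.

(** * Completion of a semi-inner product space *)

Section Completion.
Context {R : realType}.
Local Notation C := R[i].
Context (V : lmodType C) (q : {hermitian_sym V for @conjC C}).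
Hypothesis q_ge0 : forall v, 0 <= q v v.
Local Notation sn := (semi_norm q).
Local Notation F := (V -> C^o).

Definition semi_cauchy (u : nat -> V) := forall e : R, 0 < e ->
  exists N, forall m n, (N <= m)%N -> (N <= n)%N -> sn (u m - u n) < e.

(** Cauchy sequences with the same limit functional differ by a null sequence, so [f] is a canonical
    name for the class of [u] and no quotient has to be formed. *)
Definition represents (u : nat -> V) (f : F) :=
  semi_cauchy u /\ forall x, (q (u n) x : C^o) @[n --> \oo] --> f x.

Lemma semi_cauchy_const v : semi_cauchy (fun=> v).
Proof.
move=> e e0; exists 0%N => m n _ _.
by rewrite subrr -(scale0r v) semi_normZ// nr0 mul0r.
Qed.

Lemma represents_const v : represents (fun=> v) (q v).
Proof. by split; [exact: semi_cauchy_const | move=> x; exact: cvg_cst]. Qed.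

Lemma represents_lin a u w f g : represents u f -> represents w g ->
  represents (fun n => a *: u n + w n) (a *: f + g).
Proof.
move=> [cu uf] [cw wg]; split=> [e e0|x].
  have a0 : 0 < nr a + 1 by rewrite ltr_wpDl// nr_ge0.
  have [N1 H1] := cu (e / 2 / (nr a + 1)) ltac:(by rewrite !divr_gt0).
  have [N2 H2] := cw (e / 2) ltac:(by rewrite divr_gt0).
  exists (maxn N1 N2) => m n; rewrite !geq_max => /andP[m1 m2] /andP[n1 n2].
  have -> : a *: u m + w m - (a *: u n + w n) = a *: (u m - u n) + (w m - w n).
    by rewrite scalerBr opprD addrACA.
  apply: le_lt_trans (semi_normD q_ge0 _ _) _; rewrite semi_normZ//.
  have := H1 _ _ m1 n1; rewrite ltr_pdivlMr// => h1; have h2 := H2 _ _ m2 n2.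
  have := semi_norm_ge0 q (u m - u n); nra.
rewrite (_ : (fun n => _) = fun n => a * q (u n) x + q (w n) x : C^o).
  by apply: cvgD => //; apply: cvgM => //; exact: cvg_cst.
by apply/funext => n; rewrite semiDl semiZl.
Qed.

Lemma semi_cauchy_bounded u : semi_cauchy u -> exists2 M : R, 0 < M & forall n, sn (u n) <= M.
Proof.
move=> /(_ 1 ltr01)[N uN].
exists (\sum_(i < N) sn (u i) + sn (u N) + 1) => [|n].
  by rewrite ltr_wpDl// addr_ge0 ?semi_norm_ge0// sumr_ge0// => i _; exact: semi_norm_ge0.
have s0 : 0 <= \sum_(i < N) sn (u i) by rewrite sumr_ge0// => i _; exact: semi_norm_ge0.
have [nN|nN] := ltnP n N.
  rewrite (bigD1 (Ordinal nN))//= -!addrA lerDl !addr_ge0 ?semi_norm_ge0//.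
  by rewrite sumr_ge0// => i _; exact: semi_norm_ge0.
have := uN n N nN (leqnn _); have := semi_normD q_ge0 (u N) (u n - u N).
by rewrite addrC subrK; lra.
Qed.

(* Likewise <u_n, w_n> - g(u_n)^* tends to 0 if [w] represents [g], so the limit
   of <u_n, w_n> depends only on [f] and [g]. *)
Lemma represents_diff u f w : represents u f -> semi_cauchy w ->
  forall e : R, 0 < e -> exists N, forall n, (N <= n)%N -> nr (q (u n) (w n) - f (w n)) < e.
Proof.
move=> [cu uf] /semi_cauchy_bounded[M M0 wM] e e0.
have e2 : 0 < e / 2 by rewrite divr_gt0.
have [N uN] := cu (e / 2 / M) ltac:(by rewrite divr_gt0).
exists N => n nN.
(* [f] is evaluated at the moving vector [w n], so convergence gives an index [N'] that depends on
   [n]. The Cauchy property of [u] links [u n] to the later term at [maxn N N']. *)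
have [N' fN] := (cvg_seqP _ _).1 (uf (w n)) _ e2.
apply: le_lt_trans (nr_tri (q (u (maxn N N')) (w n)) _ _) _.
have h1 := fN _ (leq_maxr N N').
rewrite -semiBl.
have := semi_CauchySchwarz q_ge0 (u n - u (maxn N N')) (w n).
have := uN _ _ nN (leq_maxl N N'); rewrite ltr_pdivlMr//.
have := wM n; have := semi_norm_ge0 q (u n - u (maxn N N')); nra.
Qed.

Lemma semi_cauchy_cvg (a : nat -> C^o) :
  (forall e : R, 0 < e -> exists N, forall m n, (N <= m)%N -> (N <= n)%N ->
    nr (a m - a n) < e) ->
  exists l : C^o, a n @[n --> \oo] --> l.
Proof.
move=> ca; apply/cvg_ex.
have := @scalar_space_complete R ((a : nat -> scalar_space) n @[n --> \oo]) _.
apply; apply/cauchy_ballP => e e0.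
have eE := ge0_ReK (ltW e0).
have /ca[N aN] : 0 < complex.Re e by rewrite -ltcR eE.
exists ([set a m | m in [set m | (N <= m)%N]], [set a m | m in [set m | (N <= m)%N]]).
  by split; exists N => // m Nm; exists m.
move=> [_ _] [/= [m Nm <-] [n Nn <-]].
by rewrite -ball_normE /= nrE -eE ltcR aN.
Qed.

Lemma represents_cvg u w f : represents u f -> semi_cauchy w ->
  exists l : C^o, (q (u n) (w n) : C^o) @[n --> \oo] --> l.
Proof.
move=> [cu uf] cw; apply: semi_cauchy_cvg => e e0.
have [M M0 uM] := semi_cauchy_bounded cu.
have [K K0 wK] := semi_cauchy_bounded cw.
have [N1 H1] := cu (e / 2 / K) ltac:(by rewrite !divr_gt0).
have [N2 H2] := cw (e / 2 / M) ltac:(by rewrite !divr_gt0).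
exists (maxn N1 N2) => m n; rewrite !geq_max => /andP[m1 m2] /andP[n1 n2].
have := nr_tri (q (u n) (w m)) (q (u m) (w m)) (q (u n) (w n)).
rewrite -semiBl -semiBr.
have := semi_CauchySchwarz q_ge0 (u m - u n) (w m).
have := semi_CauchySchwarz q_ge0 (u n) (w m - w n).
have := H1 _ _ m1 n1; rewrite ltr_pdivlMr// => h1; have := H2 _ _ m2 n2.
rewrite ltr_pdivlMr//.
have := uM n; have := wK m; have := semi_norm_ge0 q (u m - u n).
have := semi_norm_ge0 q (w m - w n); nra.
Qed.

Lemma semi_cauchy_represents u : semi_cauchy u -> exists f, represents u f.
Proof.
move=> cu; suff /choice[f uf] : forall x, exists l : C^o, (q (u n) x : C^o) @[n --> \oo] --> l.
  by exists f.
move=> x; have [M M0 xM] := semi_cauchy_bounded (semi_cauchy_const x).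
apply: semi_cauchy_cvg => e e0.
have [N uN] := cu (e / M) ltac:(by rewrite divr_gt0).
exists N => m n Nm Nn; rewrite -semiBl.
apply: le_lt_trans (semi_CauchySchwarz q_ge0 _ _) _.
apply: le_lt_trans (ler_wpM2l (semi_norm_ge0 _ _) (xM 0%N)) _.
by rewrite -ltr_pdivlMr// uN.
Qed.

(** Both sequences of inner products stay close to [f (w n)], by [represents_diff]. *)
Lemma represents_cvgl u u' w f (l : C^o) : represents u f -> represents u' f ->
  semi_cauchy w -> (q (u n) (w n) : C^o) @[n --> \oo] --> l ->
  (q (u' n) (w n) : C^o) @[n --> \oo] --> l.
Proof.
move=> uf u'f cw /cvg_seqP ul; apply/cvg_seqP => e e0.
have e3 : 0 < e / 3 by rewrite divr_gt0.
have [N1 H1] := ul _ e3.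
have [N2 H2] := represents_diff uf cw e3.
have [N3 H3] := represents_diff u'f cw e3.
exists (maxn N1 (maxn N2 N3)) => n; rewrite !geq_max => /and3P[/H1 h1 /H2 h2 /H3 h3].
have := nr_tri (f (w n)) (q (u' n) (w n)) l.
have := nr_tri (q (u n) (w n)) (f (w n)) l.
by rewrite (nrC (f (w n)) (q _ _)); lra.
Qed.

(** The first sequence is exchanged by [represents_cvgl]; conjugation swaps the arguments, so the
    second one is exchanged in the same way. *)
Lemma represents_cvg_indep u u' w w' f g (l : C^o) :
  represents u f -> represents u' f -> represents w g -> represents w' g ->
  (q (u n) (w n) : C^o) @[n --> \oo] --> l ->
  (q (u' n) (w' n) : C^o) @[n --> \oo] --> l.
Proof.
move=> uf u'f wg w'g /(represents_cvgl uf u'f wg.1) /cvg_conjC.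
rewrite (_ : (fun t => _) = fun n => q (w n) (u' n) : C^o); last first.
  by apply/funext => n; rewrite -semi_hermC.
move=> /(represents_cvgl wg w'g u'f.1) /cvg_conjC; rewrite conjCK.
rewrite (_ : (fun t => _) = fun n => q (u' n) (w' n) : C^o)//.
by apply/funext => n; rewrite -semi_hermC.
Qed.

(* Elements of the completion are the functionals [x |-> lim <u_n, x>], [u]
   Cauchy.  The unused positivity argument makes the instances on [completion]
   find it in the type. *)
Definition compl_pred (_ : forall v, 0 <= q v v) : {pred F} :=
  [pred f | `[< exists u, represents u f >]].

Record completion := Completion {
  compl_fun :> F;
  compl_funP : compl_fun \in compl_pred q_ge0 }.

HB.instance Definition _ := [isSub for compl_fun].
HB.instance Definition _ := [Choice of completion by <:].

Lemma compl_pred_submod : submod_closed (compl_pred q_ge0).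
Proof.
split=> [|a f g /asboolP[u uf] /asboolP[w wg]].
  apply/asboolP; exists (fun=> 0); have -> : 0 = q 0 :> F.
    by apply/funext => x; rewrite -(scale0r (0 : V)) semiZl mul0r.
  exact: represents_const.
by apply/asboolP; exists (fun n => a *: u n + w n); exact: represents_lin.
Qed.

HB.instance Definition _ := GRing.isSubmodClosed.Build _ _ (compl_pred q_ge0)
  compl_pred_submod.
HB.instance Definition _ := [SubChoice_isSubLmodule of completion by <:].

Local Notation T := completion.

Lemma compl_ext (f g : T) : compl_fun f =1 compl_fun g -> f = g.
Proof. by move=> /funext fg; exact: val_inj. Qed.

Lemma compl_represented (f : T) : exists u, represents u f.
Proof. by case: f => f /= /asboolP. Qed.

Definition compl_seq (f : T) : nat -> V := proj1_sig (cid (compl_represented f)).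

Lemma compl_seqP f : represents (compl_seq f) f.
Proof. by rewrite /compl_seq; case: cid. Qed.

Definition compl_dot (f g : T) : C :=
  lim ((q (compl_seq f n) (compl_seq g n) : C^o) @[n --> \oo]).

(** This frees the inner product from the choice made in [compl_seq]: any representing sequences
    compute it. *)
Lemma compl_dot_cvg u w (f g : T) : represents u f -> represents w g ->
  (q (u n) (w n) : C^o) @[n --> \oo] --> (compl_dot f g : C^o).
Proof.
move=> uf wg; apply: represents_cvg_indep (compl_seqP f) uf (compl_seqP g) wg _.
have [l fgl] := represents_cvg (compl_seqP f) (compl_seqP g).1.
by apply/cvg_ex; exists l.
Qed.

Lemma compl_dotP u w (f g : T) (l : C^o) : represents u f -> represents w g ->
  (q (u n) (w n) : C^o) @[n --> \oo] --> l -> compl_dot f g = l.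
Proof.
move=> uf wg h.
exact: (cvg_unique (@norm_hausdorff _ C^o) (compl_dot_cvg uf wg) h).
Qed.

Lemma compl_dot_herm f g : compl_dot f g = (-1) ^+ false * conjC (compl_dot g f).
Proof.
rewrite expr0 mul1r; apply: (compl_dotP (compl_seqP f) (compl_seqP g)).
rewrite (_ : (fun n => _) = fun n => conjC (q (compl_seq g n) (compl_seq f n)) : C^o).
  by apply: cvg_conjC; apply: compl_dot_cvg; exact: compl_seqP.
by apply/funext => n; rewrite -semi_hermC.
Qed.

Lemma compl_dotC f g : compl_dot f g = conjC (compl_dot g f).
Proof. by rewrite compl_dot_herm expr0 mul1r. Qed.

Lemma compl_dot_linl a f g h :
  compl_dot (a *: f + g) h = a * compl_dot f h + compl_dot g h.
Proof.
have fgP := represents_lin a (compl_seqP f) (compl_seqP g).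
apply: (@compl_dotP _ _ (a *: f + g) _ _ fgP (compl_seqP h)).
rewrite (_ : (fun n => _) = fun n => a * q (compl_seq f n) (compl_seq h n) +
    q (compl_seq g n) (compl_seq h n) : C^o).
  by apply: cvgD; [apply: cvgM; [exact: cvg_cst|]|]; apply: compl_dot_cvg; exact: compl_seqP.
by apply/funext => n; rewrite semiDl semiZl.
Qed.

Lemma compl_dot_bilinear : bilinear_for *%R (conjC \; *%R) compl_dot.
Proof.
split=> [h a f g|h a f g]; first exact: compl_dot_linl.
rewrite /= [LHS]compl_dotC compl_dot_linl rmorphD rmorphM.
by rewrite (compl_dotC h f) (compl_dotC h g).
Qed.

HB.instance Definition _ :=
  @bilinear_isBilinear.Build _ _ _ _ _ _ _ compl_dot_bilinear.
HB.instance Definition _ :=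
  isHermitianSesquilinear.Build _ _ _ _ compl_dot compl_dot_herm.

Lemma compl_dot_ge0 f : 0 <= compl_dot f f.
Proof.
have /cvg_Re h := compl_dot_cvg (compl_seqP f) (compl_seqP f).
(* Hermitian symmetry makes the value real, so it suffices to pass to the limit in the real
   parts. *)
have {1}-> : compl_dot f f = (complex.Re (compl_dot f f))%:C.
  have := compl_dotC f f.
  by case: (compl_dot f f) => a b [] bE; congr Complex; rewrite /=; lra.
rewrite ler0c; apply: (closed_cvg (fun x : R => 0 <= x) _ _ _ h); first exact: closed_ge.
by apply: nearW => n; apply: ge0_Re.
Qed.

Lemma represents_le u (f : T) (e : R) : represents u f ->
  (exists N, forall n, (N <= n)%N -> sn (u n) <= e) -> semi_norm compl_dot f <= e.
Proof.
move=> uf [N uN].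
have e0 : 0 <= e := le_trans (semi_norm_ge0 _ _) (uN _ (leqnn N)).
rewrite -(@ler_pXn2r _ 2) ?nnegrE ?semi_norm_ge0// semi_norm_sqrE; last exact: compl_dot_ge0.
have /cvg_Re h := compl_dot_cvg uf uf.
apply: (closed_cvg (fun x : R => x <= e ^+ 2) _ _ _ h); first exact: closed_le.
exists N => // n Nn /=; rewrite -semi_norm_sqrE//.
by rewrite ler_pXn2r ?nnegrE ?semi_norm_ge0// uN.
Qed.

Fact compl_in_subproof v : q v \in compl_pred q_ge0.
Proof. by apply/asboolP; exists (fun=> v); exact: represents_const. Qed.

Definition compl_in v : T := Completion (compl_in_subproof v).

Lemma compl_dot_in u v : compl_dot (compl_in u) (compl_in v) = q u v.
Proof.
have h := @compl_dotP _ _ (compl_in u) (compl_in v) (q u v) (represents_const u)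
  (represents_const v).
by apply: h; exact: cvg_cst.
Qed.

(** The reproducing property. With Cauchy-Schwarz it shows that an element of norm 0 vanishes at
    every [v], so the norm is definite. *)
Lemma compl_dot_in_r f v : compl_dot f (compl_in v) = f v.
Proof.
have h := @compl_dotP _ _ f (compl_in v) (f v) (compl_seqP f) (represents_const v).
by apply: h; exact: (compl_seqP f).2.
Qed.

Lemma compl_norm_eq0 f : semi_norm compl_dot f = 0 -> f = 0.
Proof.
move=> f0; apply: compl_ext => x; apply: nr0_eq0; apply/eqP.
rewrite -compl_dot_in_r eq_le nr_ge0 andbT.
by apply: le_trans (semi_CauchySchwarz compl_dot_ge0 _ _) _; rewrite f0 mul0r.
Qed.

Definition compl_norm (f : T) : C := (semi_norm compl_dot f)%:C.

Fact compl_normD f g : compl_norm (f + g) <= compl_norm f + compl_norm g.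
Proof. by rewrite -rmorphD lecR semi_normD//; exact: compl_dot_ge0. Qed.

Fact compl_normZ a f : compl_norm (a *: f) = `|a| * compl_norm f.
Proof. by rewrite nrE -rmorphM /compl_norm semi_normZ//; exact: compl_dot_ge0. Qed.

Fact compl_norm0_eq0 f : compl_norm f = 0 -> f = 0.
Proof. by move=> /complexI/compl_norm_eq0. Qed.

HB.instance Definition _ :=
  Lmodule_isNormed.Build C completion compl_normD compl_normZ compl_norm0_eq0.

Lemma compl_nrE (f : T) : nr f = semi_norm compl_dot f.
Proof. by []. Qed.

Lemma compl_in_lin a u v : compl_in (a *: u + v) = a *: compl_in u + compl_in v.
Proof. by apply: compl_ext => x; rewrite /= semiDl semiZl. Qed.

Lemma compl_inB u v : compl_in (u - v) = compl_in u - compl_in v.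
Proof. by rewrite addrC -scaleN1r compl_in_lin scaleN1r addrC. Qed.

Lemma nr_compl_in v : nr (compl_in v) = sn v.
Proof. by rewrite compl_nrE /semi_norm /= compl_dot_in. Qed.

Lemma represents_approx u (f : T) (e : R) : represents u f -> 0 < e ->
  exists N, forall n, (N <= n)%N -> nr (f - compl_in (u n)) <= e.
Proof.
move=> uf e0; have [N uN] := uf.1 _ e0; exists N => n Nn.
(* The difference is represented by the sequence [k |-> u k - u n], whose lengths are below [e] from
   [N] on. *)
have h := represents_lin (-1) (represents_const (u n)) uf.
have E : -1 *: (q (u n) : F) + compl_fun f = compl_fun (f - compl_in (u n)).
  apply/funext => x; rewrite /= !fctE.
  by rewrite addrC scaleN1r.
rewrite E in h.
rewrite compl_nrE; apply: (represents_le h).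
by exists N => k Nk; rewrite addrC scaleN1r ltW// uN.
Qed.

Lemma compl_dense (f : T) (e : R) : 0 < e -> exists v, nr (f - compl_in v) <= e.
Proof.
move=> e0; have [N uN] := represents_approx (compl_seqP f) e0.
by exists (compl_seq f N); exact: uN.
Qed.

(** Density yields [v n] in [V] such that [G] contains the ball of radius [2 / (n + 1)] around its
    image. The sequence [v] is Cauchy, and the functional that it represents is the limit of [G]. *)
Lemma compl_complete (G : set_system T) : ProperFilter G -> cauchy G -> cvg G.
Proof.
move=> GG /cauchyP Gc.
have /choice[v Gv] : forall n : nat, exists v,
    G [set g : T | nr (g - compl_in v) < 2 * n.+1%:R^-1].
  move=> n; have n0 : 0 < (n.+1%:R^-1 : R) by rewrite invr_gt0 ltr0n.
  have [|f Gf] := Gc (n.+1%:R^-1)%:C; first by rewrite ltcR.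
  have [v fv] := compl_dense f n0; exists v; apply: filterS Gf => g.
  rewrite -ball_normE /= nrE ltcR => fg.
  by apply: lt_le_trans (nr_distl fg fv) _; rewrite mulr_natl.
have cv : semi_cauchy v.
  move=> e e0.
  (* Two radii [2 / (m + 1)] and [2 / (n + 1)] are added, so each inverse has to lie below
     [e / 4]. *)
  have e4 : 0 < e / 4 by rewrite divr_gt0.
  have [N _ NP] := near_infty_natSinv_lt (PosNum e4).
  exists N => m n Nm Nn.
  have [g [gm gn]] := filter_ex (filterI (Gv m) (Gv n)).
  rewrite -nr_compl_in compl_inB.
  apply: lt_le_trans (nr_distl gm (ltW gn)) _; clear gm gn.
  have inv_le k : (N <= k)%N -> k.+1%:R^-1 <= N.+1%:R^-1 :> R.
    by move=> Nk; rewrite lef_pV2 ?posrE ?ler_nat.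
  have : N.+1%:R^-1 < e / 4 by exact: NP (leqnn N).
  move: (inv_le _ Nm) (inv_le _ Nn).
  move: (N.+1%:R^-1) (m.+1%:R^-1) (n.+1%:R^-1) => a b c; lra.
have [f0 vf0] := semi_cauchy_represents cv.
have f0P : f0 \in compl_pred q_ge0 by apply/asboolP; exists v.
pose f : T := Completion f0P; have vf : represents v f by [].
apply/cvg_ex; exists f; apply/cvg_nrP => e e0.
have e2 : 0 < e / 2 by rewrite divr_gt0.
have [N vN] := represents_approx vf e2.
have e4 : 0 < e / 4 by rewrite divr_gt0.
have [M _ MP] := near_infty_natSinv_lt (PosNum e4).
apply: filterS (Gv (maxn N M)) => g gv.
apply: lt_le_trans (nr_distr gv (vN _ (leq_maxl N M))) _ => {gv}.
have : M.+1%:R^-1 < e / 4 by exact: MP (leqnn M).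
have : (maxn N M).+1%:R^-1 <= M.+1%:R^-1 :> R.
  by rewrite lef_pV2 ?posrE ?ler_nat ?ltnS ?leq_maxr.
move: (M.+1%:R^-1) ((maxn N M).+1%:R^-1) => a b; lra.
Qed.

HB.instance Definition _ := Uniform_isComplete.Build completion compl_complete.

Fact compl_dot_gt0 f : f != 0 -> 0 < compl_dot f f.
Proof.
move=> fn0; rewrite lt_def compl_dot_ge0 andbT; apply/eqP => f0.
move/eqP: fn0; apply; apply: compl_norm_eq0.
by rewrite /semi_norm /= f0 sqrtr0.
Qed.

HB.instance Definition _ := isDotProduct.Build _ _ compl_dot compl_dot_gt0.

Fact compl_dot_norm (f : T) : compl_dot f f = `|f| ^+ 2.
Proof. by rewrite (semi_norm_sqr compl_dot_ge0) nrE -rmorphXn. Qed.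

HB.instance Definition _ := hasInner.Build R completion compl_dot_norm.

Section Lift.
Context (A B : V -> V).
Hypothesis AL : linear A.
Hypothesis AB : forall u v, q (A u) v = q u (B v).
Hypothesis BA : forall v, B (A v) = v.

(** From <A u_n, x> = <u_n, B x>: on functionals the extension of [A] to the completion is
    precomposition with its adjoint [B]. *)
Lemma represents_lift u f : represents u f -> represents (A \o u) (f \o B).
Proof.
move=> [cu uf]; split=> [e /cu[N uN]|x].
  exists N => m n Nm Nn; rewrite /=.
  have -> : A (u m) - A (u n) = A (u m - u n).
    by rewrite addrC -scaleN1r -AL scaleN1r addrC.
  by rewrite /semi_norm AB BA; exact: uN.
rewrite (_ : (fun n => _) = fun n => q (u n) (B x) : C^o); first exact: uf.
by apply/funext => n; rewrite /= AB.
Qed.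

Fact compl_lift_subproof (f : T) : (compl_fun f \o B) \in compl_pred q_ge0.
Proof.
apply/asboolP; have [u uf] := compl_represented f.
by exists (A \o u); exact: represents_lift.
Qed.

Definition compl_lift (f : T) : T := Completion (compl_lift_subproof f).

Lemma compl_lift_linear : linear compl_lift.
Proof. by move=> a f g; apply: compl_ext. Qed.

Lemma compl_lift_dot f g : compl_dot (compl_lift f) (compl_lift g) = compl_dot f g.
Proof.
have fP := represents_lift (compl_seqP f); have gP := represents_lift (compl_seqP g).
have h := @compl_dotP _ _ (compl_lift f) (compl_lift g) (compl_dot f g) fP gP.
apply: h; have := compl_dot_cvg (compl_seqP f) (compl_seqP g).
rewrite [X in X @ _ --> _](_ : _ = fun n =>
  q ((A \o compl_seq f) n) ((A \o compl_seq g) n) : C^o)//.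
by apply/funext => n; rewrite /= AB BA.
Qed.

Lemma compl_lift_in v : compl_lift (compl_in v) = compl_in (A v).
Proof. by apply: compl_ext => x /=; rewrite AB. Qed.

End Lift.

Lemma compl_lift_unitary (A B : V -> V) (AL : linear A) (BL : linear B)
    (AB : forall u v, q (A u) v = q u (B v)) (BA : forall v, B (A v) = v)
    (AB1 : forall v, A (B v) = v) :
  unitary (compl_lift AL AB BA).
Proof.
split=> [|g|f g]; first exact: compl_lift_linear; last exact: compl_lift_dot.
have BAq u v : q (B u) v = q u (A v) by rewrite -{1}(BA v) -AB AB1.
exists (compl_lift BL BAq AB1 g); apply: compl_ext => x /=.
by rewrite AB1.
Qed.

End Completion.

(** * Hilbert tensor products and tensor product representations *)

Section FiniteRank.
Context {R : realType} (H K : hilbertType R).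
Local Notation C := R[i].
Local Notation F := ((H * K)%type -> C^o).
Implicit Types (p z : (H * K)%type) (s : seq (H * K)).

(** The tensor x (x) y is encoded by its inner products with all pure tensors. The function
    [elems s] is then a finite sum of pure tensors, and [pairing f s] is the inner product of [f]
    with [elems s]. *)
Definition elem p : F := fun z => inner p.1 z.1 * inner p.2 z.2.
Definition elems s : F := \sum_(p <- s) elem p.
Definition pairing (f : F) s : C := \sum_(p <- s) f p.

Lemma elemsE s z : elems s z = \sum_(p <- s) elem p z.
Proof. by rewrite /elems; elim/big_ind2 : _ => // f a g b <- <-. Qed.

Lemma elemC p z : elem p z = conjC (elem z p).
Proof. by rewrite /elem conjCM -!innerC. Qed.

Lemma pairingC s s' : pairing (elems s) s' = conjC (pairing (elems s') s).
Proof.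
rewrite /pairing conjC_sum.
under eq_bigr do rewrite elemsE; under [RHS]eq_bigr do rewrite elemsE conjC_sum.
rewrite exchange_big; apply: eq_bigr => p _; apply: eq_bigr => z _.
exact: elemC.
Qed.

Lemma elems_cat s s' : elems (s ++ s') = elems s + elems s'.
Proof. exact: big_cat. Qed.

Lemma elem_scale a p : elem (a *: p.1, p.2) = a *: elem p.
Proof. by apply/funext => z; rewrite /elem /= innerZl -mulrA. Qed.

(* Splitting off the component of every second factor along the first one
   reduces positivity to a shorter list orthogonal to the first tensor. *)
Lemma pairing_ge0 s : 0 <= pairing (elems s) s.
Proof.
have [n] := ubnP (size s); elim: n s => // n IH [|[x0 y0] s] /= sn.
  by rewrite /pairing big_nil.
have [y00|y0n0] := eqVneq y0 0.
  have e0 : elem (x0, y0) = 0.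
    by apply/funext => z; rewrite /elem /= y00 inner0l mulr0.
  have -> : elems ((x0, y0) :: s) = elems s by rewrite /elems big_cons e0 add0r.
  rewrite /pairing big_cons elemsE big1 ?add0r; first exact: IH.
  by move=> p _; rewrite elemC e0 conjC0.
pose c p := inner p.2 y0 / inner y0 y0.
pose s1 := [seq (p.1, p.2 - c p *: y0) | p <- s].
pose X := x0 + \sum_(p <- s) c p *: p.1.
have n0 : inner y0 y0 != 0 by rewrite inner_eq0.
(* The parts along [y0] of all second factors are collected into the first factor [X]. *)
have sE : elems ((x0, y0) :: s) = elems ((X, y0) :: s1).
  apply/funext => z; rewrite !elemsE !big_cons /s1 big_map /elem /=.
  rewrite /X innerDl mulrDl -addrA; congr (_ + _).
  rewrite inner_suml mulr_suml -big_split /=; apply: eq_bigr => p _.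
  by rewrite innerZl innerBl innerZl; ring.
have orth p : p \in s1 -> inner p.2 y0 = 0.
  move=> /mapP[p' _ ->] /=; rewrite innerBl innerZl /c divfK ?subrr//.
(* By [pairingC] the pairing depends on its list only through the tensor, so the list may be
   replaced in both places. *)
have -> : pairing (elems ((x0, y0) :: s)) ((x0, y0) :: s) =
          conjC (pairing (elems ((X, y0) :: s1)) ((X, y0) :: s1)).
  by rewrite [in LHS]sE pairingC sE.
rewrite conjC_ge0 /pairing big_cons elemsE big_cons big1_seq ?addr0; last first.
  by move=> p /andP[_ /orth p0]; rewrite /elem p0 mulr0.
rewrite addr_ge0 ?mulr_ge0 ?inner_ge0//.
rewrite (eq_big_seq (elems s1)); last first.
  move=> p /orth p0; rewrite !elemsE big_cons elemC /elem /= p0 mulr0 conjC0.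
  by rewrite add0r.
by apply: IH; rewrite size_map.
Qed.

Definition finite_rank : {pred F} := [pred f | `[< exists s, f = elems s >]].

Lemma finite_rank_submod : submod_closed finite_rank.
Proof.
split=> [|a f g /asboolP[s ->] /asboolP[s' ->]].
  by apply/asboolP; exists [::]; rewrite /elems big_nil.
apply/asboolP; exists ([seq (a *: p.1, p.2) | p <- s] ++ s').
rewrite elems_cat /elems big_map scaler_sumr; congr (_ + _).
by apply: eq_bigr => p _; rewrite elem_scale.
Qed.

HB.instance Definition _ := GRing.isSubmodClosed.Build _ _ finite_rank
  finite_rank_submod.

Record pretensor := Pretensor {
  pretensor_fun :> F;
  pretensor_funP : pretensor_fun \in finite_rank }.

HB.instance Definition _ := [isSub for pretensor_fun].
HB.instance Definition _ := [Choice of pretensor by <:].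
HB.instance Definition _ := [SubChoice_isSubLmodule of pretensor by <:].

Lemma pretensor_ext (f g : pretensor) : pretensor_fun f =1 pretensor_fun g -> f = g.
Proof. by move=> /funext fg; exact: val_inj. Qed.

Lemma pretensorP (f : pretensor) : exists s, pretensor_fun f = elems s.
Proof. by case: f => f /= /asboolP. Qed.

Definition pretensor_seq (f : pretensor) := proj1_sig (cid (pretensorP f)).

Lemma pretensor_seqP f : pretensor_fun f = elems (pretensor_seq f).
Proof. by rewrite /pretensor_seq; case: cid. Qed.

Definition pretensor_dot (f g : pretensor) : C := pairing f (pretensor_seq g).

(** Conjugate symmetry moves the list of [g] into the function argument, where only its sum counts;
    hence every list for [g] gives the same value. *)
Lemma pretensor_dotE (f g : pretensor) s : pretensor_fun g = elems s ->
  pretensor_dot f g = pairing f s.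
Proof.
move=> gs; rewrite /pretensor_dot pretensor_seqP pairingC -pretensor_seqP gs.
by rewrite -pairingC.
Qed.

Lemma pretensor_dotC f g : pretensor_dot f g = conjC (pretensor_dot g f).
Proof. by rewrite /pretensor_dot (pretensor_seqP f) (pretensor_seqP g) pairingC. Qed.

Lemma pretensor_dot_linl a f g h :
  pretensor_dot (a *: f + g) h = a * pretensor_dot f h + pretensor_dot g h.
Proof. by rewrite /pretensor_dot /pairing mulr_sumr -big_split. Qed.

Fact pretensor_dot_bilinear : bilinear_for *%R (conjC \; *%R) pretensor_dot.
Proof.
split=> [h a f g|h a f g]; first exact: pretensor_dot_linl.
rewrite /= [LHS]pretensor_dotC pretensor_dot_linl conjCD conjCM.
by rewrite (pretensor_dotC h f) (pretensor_dotC h g).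
Qed.

HB.instance Definition _ :=
  @bilinear_isBilinear.Build _ _ _ _ _ _ _ pretensor_dot_bilinear.

Fact pretensor_dot_herm f g :
  pretensor_dot f g = (-1) ^+ false * conjC (pretensor_dot g f).
Proof. by rewrite expr0 mul1r; exact: pretensor_dotC. Qed.

HB.instance Definition _ :=
  isHermitianSesquilinear.Build _ _ _ _ pretensor_dot pretensor_dot_herm.

Lemma pretensor_dot_ge0 (f : pretensor) : 0 <= pretensor_dot f f.
Proof. by rewrite /pretensor_dot {1}pretensor_seqP pairing_ge0. Qed.

Fact pure_subproof p : elem p \in finite_rank.
Proof. by apply/asboolP; exists [:: p]; rewrite /elems big_seq1. Qed.

Definition pure p : pretensor := Pretensor (pure_subproof p).

Lemma pretensor_dot_pure (f : pretensor) p : pretensor_dot f (pure p) = f p.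
Proof.
rewrite (@pretensor_dotE _ _ [:: p]); first by rewrite /pairing big_seq1.
by rewrite /elems big_seq1.
Qed.

Lemma pretensor_sum_pure (f : pretensor) : exists s, f = \sum_(p <- s) pure p.
Proof.
have [s fs] := pretensorP f; exists s; apply: val_inj; rewrite /= fs {fs}.
by elim: s => [|p s IH]; rewrite /elems ?big_nil// !big_cons /= -IH.
Qed.

End FiniteRank.

Section TensorLift.
Context {R : realType} (H K : hilbertType R).
Context (U U' : H -> H) (W W' : K -> K).
Hypothesis UU' : forall x y, inner (U x) y = inner x (U' y).
Hypothesis WW' : forall x y, inner (W x) y = inner x (W' y).

(** As a tensor is the function of its inner products, the operator U (x) W acts by precomposition
    with the adjoints of its factors. *)
Lemma elem_lift (p : (H * K)%type) :
  elem (U p.1, W p.2) = elem p \o (fun z => (U' z.1, W' z.2)).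
Proof. by apply/funext => z; rewrite /elem /= UU' WW'. Qed.

Lemma elems_lift (s : seq (H * K)) :
  elems [seq (U p.1, W p.2) | p <- s] = elems s \o (fun z => (U' z.1, W' z.2)).
Proof.
apply/funext => z /=; rewrite !elemsE big_map; apply: eq_bigr => p _.
by rewrite elem_lift.
Qed.

Fact pretensor_lift_subproof (f : pretensor H K) :
  (pretensor_fun f \o (fun z => (U' z.1, W' z.2))) \in @finite_rank R H K.
Proof.
by apply/asboolP; have [s ->] := pretensorP f; rewrite -elems_lift; eexists.
Qed.

Definition pretensor_lift f := Pretensor (pretensor_lift_subproof f).

Lemma pretensor_lift_linear : linear pretensor_lift.
Proof. by move=> a f g; apply: pretensor_ext. Qed.

Lemma pretensor_lift_pure p : pretensor_lift (pure p) = pure (U p.1, W p.2).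
Proof. by apply: pretensor_ext => z /=; rewrite elem_lift. Qed.

End TensorLift.

Section TensorProduct.
Context {R : realType} (H K : hilbertType R).

Section Lift.
Context (U U' : H -> H) (W W' : K -> K).
Hypothesis UU' : forall x y, inner (U x) y = inner x (U' y).
Hypothesis WW' : forall x y, inner (W x) y = inner x (W' y).
Hypotheses (UK : cancel U U') (U'K : cancel U' U).
Hypotheses (WK : cancel W W') (W'K : cancel W' W).

Let U'U x y : inner (U' x) y = inner x (U y).
Proof. by rewrite -{1}(UK y) -UU' U'K. Qed.

Let W'W x y : inner (W' x) y = inner x (W y).
Proof. by rewrite -{1}(WK y) -WW' W'K. Qed.

Local Notation A := (pretensor_lift UU' WW').
Local Notation B := (pretensor_lift U'U W'W).

Lemma pretensor_lift_adj (u v : pretensor H K) :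
  pretensor_dot (A u) v = pretensor_dot u (B v).
Proof.
have [s vs] := pretensorP v.
rewrite (@pretensor_dotE _ _ _ _ _ s)//.
rewrite (@pretensor_dotE _ _ _ _ _ [seq (U' p.1, W' p.2) | p <- s]).
  by rewrite /pairing big_map.
by rewrite (elems_lift U'U W'W) /= vs.
Qed.

Lemma pretensor_liftK : cancel A B.
Proof. by move=> f; apply: pretensor_ext => -[x y] /=; rewrite UK WK. Qed.

Lemma pretensor_liftKV : cancel B A.
Proof. by move=> f; apply: pretensor_ext => -[x y] /=; rewrite U'K W'K. Qed.

End Lift.

Lemma unitary_inv (E : hilbertType R) (U : E -> E) : unitary U ->
  exists U' : E -> E, [/\ forall x y, inner (U x) y = inner x (U' y),
    cancel U U' & cancel U' U].
Proof.
move=> [Ul Us Ui]; have [U' U'P] := choice Us; exists U'.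
have U'K : cancel U' U by [].
have UK : cancel U U'.
  move=> x; apply/eqP; rewrite -subr_eq0 -inner_eq0 -Ui.
  have -> : U (U' (U x) - x) = 0.
    by rewrite addrC -scaleN1r Ul U'P scaleN1r addNr.
  by rewrite inner0l.
by split=> // x y; rewrite -{1}(U'K y) Ui.
Qed.

(** The space is the completion of the finite sums of pure tensors. Two unitaries act on these sums
    through their inverses as adjoints, and the action extends to the completion. *)
Theorem hilbert_tensor_exists :
  exists (T : hilbertType R) (t : {bilinear H -> K -> T}),
    hilbert_tensor t /\
    forall U W, unitary U -> unitary W -> exists A : T -> T,
      unitary A /\ forall x y, A (t x y) = t (U x) (W y).
Proof.
pose T := completion (@pretensor_dot_ge0 R H K).
pose t0 (x : H) (y : K) : T := compl_in (@pretensor_dot_ge0 R H K) (pure (x, y)).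
have t0B : bilinear_for *:%R *:%R t0.
  split=> [y a x x'|x a y y']; rewrite /t0 -compl_in_lin; congr compl_in;
    apply: pretensor_ext => z /=; rewrite /elem /=.
    by rewrite innerDl innerZl mulrDl -mulrA.
  by rewrite innerDl innerZl mulrDr mulrCA.
pose tM := bilinear_isBilinear.Build _ _ _ _ _ _ t0 t0B.
pose t : {bilinear H -> K -> T} := HB.pack t0 tM.
exists T, t; split; [split|].
- move=> x y x' y'; rewrite -[LHS]/(compl_dot _ _) compl_dot_in /=.
  by rewrite pretensor_dot_pure.
- apply/seteqP; split=> // f _ B /nbhs_ballP[e /= e0 eB].
  have e2 : 0 < complex.Re e / 2 by rewrite divr_gt0// -ltcR ge0_ReK// ltW.
  have [v fv] := compl_dense f e2; have [s vs] := pretensor_sum_pure v.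
  exists (compl_in (@pretensor_dot_ge0 R H K) v); split.
    exists s => //; rewrite vs; elim: s {vs} => [|p s IH].
      rewrite !big_nil; apply: compl_ext => x; by rewrite /= linear0l.
    rewrite !big_cons IH -[X in compl_in _ (X + _)]scale1r compl_in_lin scale1r.
    by case: p.
  apply: eB; rewrite -ball_normE /= nrE.
  rewrite -(ge0_ReK (ltW e0)) ltcR; apply: le_lt_trans fv _.
  by rewrite gtr_pMr ?invf_lt1 ?ltr1n//; lra.
- move=> U W /unitary_inv[U' [UU' UK U'K]] /unitary_inv[W' [WW' WK W'K]].
  pose A := pretensor_lift UU' WW'.
  have AB := pretensor_lift_adj UU' WW' UK U'K WK W'K.
  have AK := pretensor_liftK UU' WW' UK U'K WK W'K.
  have AKV := pretensor_liftKV UU' WW' UK U'K WK W'K.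
  have AL := pretensor_lift_linear UU' WW'.
  exists (compl_lift (q := (@pretensor_dot R H K)) AL AB AK).
  split; first by apply: compl_lift_unitary => //; exact: pretensor_lift_linear.
  move=> x y; rewrite -[LHS]/(compl_lift _ _ _ (compl_in _ _)) compl_lift_in.
  by rewrite pretensor_lift_pure.
Qed.

End TensorProduct.

(** * Unitary operators and unitary representations *)

Section Unitary.
Context {R : realType} {H : hilbertType R}.
Implicit Types U : H -> H.

Lemma unitaryD U x y : unitary U -> U (x + y) = U x + U y.
Proof. by move=> [Ul _ _]; rewrite -[x in LHS]scale1r Ul scale1r. Qed.

Lemma unitary0 U : unitary U -> U 0 = 0.
Proof. by move=> Uu; apply: (@addrI _ (U 0)); rewrite -unitaryD// !addr0. Qed.

Lemma unitaryZ U a x : unitary U -> U (a *: x) = a *: U x.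
Proof. by move=> Uu; have [Ul _ _] := Uu; rewrite -[a *: x]addr0 Ul unitary0// addr0. Qed.

Lemma unitaryB U x y : unitary U -> U (x - y) = U x - U y.
Proof. by move=> Uu; rewrite -[- y]scaleN1r unitaryD// unitaryZ// scaleN1r. Qed.

Lemma unitary_sum I (s : seq I) (F : I -> H) U : unitary U ->
  U (\sum_(i <- s) F i) = \sum_(i <- s) U (F i).
Proof.
by move=> Uu; elim: s => [|i s IH]; rewrite ?big_nil ?unitary0// !big_cons unitaryD// IH.
Qed.

Lemma unitary_nr U x : unitary U -> nr (U x) = nr x.
Proof. by move=> [_ _ Ui]; rewrite -!semi_norm_inner /semi_norm /= Ui. Qed.

Lemma unitary_comp U U' : unitary U -> unitary U' -> unitary (U \o U').
Proof.
move=> Uu U'u; split=> [a x y|y|x y] /=.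
- by rewrite !(unitaryD, unitaryZ).
- have [_ Us _] := Uu; have [_ U's _] := U'u.
  by have [x <-] := Us y; have [z <-] := U's x; exists z.
- by have [_ _ Ui] := Uu; have [_ _ U'i] := U'u; rewrite Ui U'i.
Qed.

Lemma unitary_id : unitary (@id H).
Proof. by split=> // y; exists y. Qed.

End Unitary.

Section UnitaryRep.
Context {R : realType} {A : preTopologicalGroupType} (G : set A) (gG : subgroup G).
Context {H : hilbertType R} (rho : A -> H -> H) (rho_rep : unitary_rep G rho).

Lemma rep_unitary g : G g -> unitary (rho g).
Proof. by have [+ _ _] := rho_rep; apply. Qed.

Lemma repM g h x : G g -> G h -> rho (g * h)%g x = rho g (rho h x).
Proof. by have [_ rM _] := rho_rep => Gg Gh; rewrite rM. Qed.

Lemma rep1 x : rho 1%g x = x.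
Proof.
have [G1 _ _] := gG; have [_ r1s _] := rep_unitary G1.
by have [y <-] := r1s x; rewrite -repM// mulg1.
Qed.

Lemma repVK g x : G g -> rho g (rho g^-1%g x) = x.
Proof. by move=> Gg; have [_ _ /(_ _ Gg) GV] := gG; rewrite -repM// mulgV rep1. Qed.

Lemma rep_nr g x : G g -> nr (rho g x) = nr x.
Proof. by move=> Gg; apply/unitary_nr/rep_unitary. Qed.

Lemma rep_inner g x y : G g -> inner (rho g x) (rho g y) = inner x y.
Proof. by move=> /rep_unitary[_ _]; apply. Qed.

Lemma rep_adj g x y : G g -> inner (rho g x) y = inner x (rho g^-1%g y).
Proof. by move=> Gg; rewrite -{1}(repVK y Gg) rep_inner. Qed.

Lemma rep_continuous x g : G g -> forall e : R, 0 < e ->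
  \forall h \near within G (nbhs g), nr (rho h x - rho g x) < e.
Proof.
move=> Gg; have [_ _ /(_ x)/subspace_continuousP/(_ g Gg) c] := rho_rep.
exact/cvg_nrP.
Qed.

End UnitaryRep.

Lemma unitary_rep_sub (R : realType) (A : preTopologicalGroupType) (G G' : set A)
    (H : hilbertType R) (rho : A -> H -> H) :
  G' `<=` G -> unitary_rep G rho -> unitary_rep G' rho.
Proof.
move=> sub [ru rM rc]; split=> [g /sub/ru//|g h /sub Gg /sub Gh|x]; first exact: rM.
exact: continuous_subspaceW (rc x).
Qed.

Lemma conj_rep_unitary (R : realType) (A : preTopologicalGroupType) (G : set A)
    (H : hilbertType R) (rho : A -> H -> H) :
  unitary_rep G rho -> unitary_rep G (conj_rep rho).
Proof.
move=> [ru rM rc]; split=> // g /ru[gl gs gi]; split=> //.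
  by move=> a x y; exact: gl.
by move=> x y; exact: gi.
Qed.

Section HilbertTensor.
Context {R : realType} {H K T : hilbertType R} (t : {bilinear H -> K -> T}).
Hypothesis tT : hilbert_tensor t.

Lemma tensor_inner x y x' y' : inner (t x y) (t x' y') = inner x x' * inner y y'.
Proof. by have [] := tT. Qed.

Lemma tensor_nr x y : nr (t x y) = nr x * nr y.
Proof.
apply: (@pexpIrn _ 2) => //; rewrite ?nnegrE ?mulr_ge0 ?nr_ge0//.
by apply: complexI; rewrite -inner_nr tensor_inner !inner_nr -rmorphM exprMn.
Qed.

Lemma tensorBl x x' y : t (x - x') y = t x y - t x' y.
Proof. exact: linearBl. Qed.

Lemma tensorBr x y y' : t x (y - y') = t x y - t x y'.
Proof. exact: linearBr. Qed.

Lemma tensor_dense f (e : R) : 0 < e ->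
  exists s : seq (H * K), nr (\sum_(p <- s) t p.1 p.2 - f) < e.
Proof.
move=> e0; have [_ dense] := tT.
have : closure [set \sum_(p <- s) t p.1 p.2 | s in [set: seq (H * K)]] f.
  by rewrite dense.
move=> /(_ (ball f e%:C))[]; first by apply: nbhsx_ballx; rewrite ltcR.
move=> _ [[s _ <-]]; rewrite -ball_normE /= nrE ltcR => h.
by exists s; rewrite nrC.
Qed.

Lemma tensor_unitary_eq (U U' : T -> T) : unitary U -> unitary U' ->
  (forall x y, U (t x y) = U' (t x y)) -> U =1 U'.
Proof.
move=> Uu U'u UU' f; apply/eqP; rewrite -subr_eq0; apply/eqP/nr0_eq0/eqP.
rewrite eq_le nr_ge0 andbT leNgt; apply/negP => h.
(* For a finite sum [g] this close to [f], where both operators agree, isometry gives |U f - U' f|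
   <= 2 |g - f|, a contradiction. *)
have e0 : 0 < nr (U f - U' f) / 2 by rewrite divr_gt0.
have [s fs] := tensor_dense f e0; set g := \sum_(p <- s) _ in fs.
have Ug : U g = U' g.
  by rewrite /g !unitary_sum//; apply: eq_bigr => p _; exact: UU'.
have h1 : nr (U f - U g) = nr (g - f) by rewrite -unitaryB// unitary_nr// nrC.
have h2 : nr (U g - U' f) = nr (g - f) by rewrite Ug -unitaryB// unitary_nr.
by have := nr_tri (U g) (U f) (U' f); rewrite h1 h2; lra.
Qed.

End HilbertTensor.

Section TensorRep.
Context {R : realType} {A : preTopologicalGroupType} (G : set A) (gG : subgroup G).
Context {H K : hilbertType R} (rho : A -> H -> H) (sigma : A -> K -> K).
Hypotheses (rho_rep : unitary_rep G rho) (sigma_rep : unitary_rep G sigma).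

(** Each [tau g] is the lift of a pair of unitaries. Multiplicativity holds since unitaries agreeing
    on pure tensors are equal, and strong continuity is checked on finite sums, which are dense. *)
Theorem tensor_rep_exists : exists (T : hilbertType R) (t : {bilinear H -> K -> T})
  (tau : A -> T -> T), tensor_rep G t rho sigma tau.
Proof.
have [T [t [tT lift]]] := hilbert_tensor_exists H K.
have /choice[tau tauP] : forall g, exists B : T -> T, unitary B /\
    (G g -> forall x y, B (t x y) = t (rho g x) (sigma g y)).
  move=> g; have [Gg|nGg] := pselect (G g).
    have [B [Bu Bt]] := lift _ _ (rep_unitary rho_rep Gg) (rep_unitary sigma_rep Gg).
    by exists B.
  (* Outside [G] the identity is a default value that keeps [tau g] unitary for every [g]. *)
  by exists id; split => //; exact: unitary_id.
have tau_t g x y : G g -> tau g (t x y) = t (rho g x) (sigma g y).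
  by move=> Gg; have [_ ->] := tauP g.
have tau_u g : unitary (tau g) by have [] := tauP g.
exists T, t, tau; split => //.
have [_ GM _] := gG.
split=> // [g h Gg Gh|f].
  apply: (tensor_unitary_eq tT) => // [|x y]; first exact: unitary_comp.
  by rewrite /= !tau_t//; [rewrite (repM rho_rep)// (repM sigma_rep)|exact: GM].
apply/subspace_continuousP => g Gg; apply/cvg_nrP => e e0.
have Gnear : \forall h \near within G (nbhs g), G h by exact: withinT.
have e3 : 0 < e / 3 by rewrite divr_gt0.
have [s fs] := tensor_dense tT f e3.
suff : \forall h \near within G (nbhs g),
    nr (tau h (\sum_(p <- s) t p.1 p.2) - tau g (\sum_(p <- s) t p.1 p.2)) < e / 3.
  move: fs; set k := \sum_(p <- s) _ => fs; apply: filterS => h hk.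
  have h1 : nr (tau h f - tau h k) = nr (k - f) by rewrite -unitaryB// unitary_nr// nrC.
  have h2 : nr (tau g k - tau g f) = nr (k - f) by rewrite -unitaryB// unitary_nr.
  have := nr_tri (tau h k) (tau h f) (tau g f).
  by have := nr_tri (tau g k) (tau h k) (tau g f); rewrite h1 h2; lra.
elim: s {fs} (e / 3) e3 => [|[x y] s IH] d d0.
  by apply: nearW => h; rewrite big_nil (unitary0 (tau_u h)) (unitary0 (tau_u g)) subr0 nr0.
have d2 : 0 < d / 2 by rewrite divr_gt0.
(* The change of x (x) y splits into one change per factor, each allowed [d / 4]; the [+ 1] keeps
   the divisor positive when the other factor is 0. *)
have dx : 0 < d / 4 / (nr y + 1) by rewrite !divr_gt0// ltr_wpDl// nr_ge0.
have dy : 0 < d / 4 / (nr x + 1) by rewrite !divr_gt0// ltr_wpDl// nr_ge0.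
have nx := rep_continuous rho_rep x Gg dx.
have ny := rep_continuous sigma_rep y Gg dy.
apply: filterS (filterI Gnear (filterI nx (filterI ny (IH _ d2)))) => h [Gh [hx [hy hs]]].
rewrite big_cons (unitaryD _ _ (tau_u h)) (unitaryD _ _ (tau_u g)) !tau_t//= opprD addrACA.
apply: le_lt_trans (nrD _ _) _.
suff : nr (t (rho h x) (sigma h y) - t (rho g x) (sigma g y)) <= d / 2 by lra.
have -> : t (rho h x) (sigma h y) - t (rho g x) (sigma g y) =
    t (rho h x - rho g x) (sigma h y) + t (rho g x) (sigma h y - sigma g y).
  by rewrite tensorBl tensorBr addrA subrK.
apply: le_trans (nrD _ _) _; rewrite !(tensor_nr tT) (rep_nr sigma_rep)// (rep_nr rho_rep)//.
move: hx hy; rewrite !ltr_pdivlMr ?ltr_wpDl ?nr_ge0//.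
have := nr_ge0 x; have := nr_ge0 y; have := nr_ge0 (rho h x - rho g x).
have := nr_ge0 (sigma h y - sigma g y); nra.
Qed.

End TensorRep.

(** * Invariant vectors in convex hulls *)

Section RealInner.
Context {R : realType} {H : hilbertType R}.
Implicit Types x y z : H.

Definition rip x y : R := complex.Re (inner x y).

Lemma ripC x y : rip x y = rip y x.
Proof. by rewrite /rip innerC Re_conjC. Qed.

Lemma ripDl x y z : rip (x + y) z = rip x z + rip y z.
Proof. by rewrite /rip innerDl ReD. Qed.

Lemma ripDr x y z : rip z (x + y) = rip z x + rip z y.
Proof. by rewrite /rip innerDr ReD. Qed.

Lemma ripBl x y z : rip (x - y) z = rip x z - rip y z.
Proof. by rewrite /rip innerBl ReB. Qed.

Lemma ripBr x y z : rip z (x - y) = rip z x - rip z y.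
Proof. by rewrite /rip innerBr ReB. Qed.

Lemma ripZl (a : R) x y : rip (a%:C *: x) y = a * rip x y.
Proof. by rewrite /rip innerZl ReZ. Qed.

Lemma ripZr (a : R) x y : rip x (a%:C *: y) = a * rip x y.
Proof. by rewrite ripC ripZl ripC. Qed.

Lemma rip_suml I (s : seq I) (F : I -> H) y :
  rip (\sum_(i <- s) F i) y = \sum_(i <- s) rip (F i) y.
Proof. by rewrite /rip inner_suml Re_sum. Qed.

Lemma rip_sumr I (s : seq I) (F : I -> H) y :
  rip y (\sum_(i <- s) F i) = \sum_(i <- s) rip y (F i).
Proof. by rewrite ripC rip_suml; apply: eq_bigr => i _; exact: ripC. Qed.

Lemma rip_nr x : rip x x = nr x ^+ 2.
Proof. by rewrite /rip inner_nr. Qed.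

Lemma rip_CauchySchwarz x y : `|rip x y| <= nr x * nr y.
Proof. exact: le_trans (Re_le_nr _) (inner_CauchySchwarz _ _). Qed.

Lemma nrD_sqr x y : nr (x + y) ^+ 2 = nr x ^+ 2 + nr y ^+ 2 + 2 * rip x y.
Proof. by rewrite -!rip_nr ripDl !ripDr (ripC y x); ring. Qed.

Lemma nrB_sqr x y : nr (x - y) ^+ 2 = nr x ^+ 2 + nr y ^+ 2 - 2 * rip x y.
Proof. by rewrite -!rip_nr ripBl !ripBr (ripC y x); ring. Qed.

Lemma parallelogram x y :
  nr (x - y) ^+ 2 = 2 * nr x ^+ 2 + 2 * nr y ^+ 2 - 4 * nr ((2^-1)%:C *: (x + y)) ^+ 2.
Proof.
rewrite nrB_sqr nrZ nr_real exprMn nrD_sqr.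
rewrite real_normK ?num_real// exprVn.
by move: (rip x y) (nr x) (nr y) => p a b; field.
Qed.

End RealInner.

Section InvariantVector.
Context {R : realType} {A : preTopologicalGroupType} (B : set A) (gB : subgroup B).
Context {H : hilbertType R} (rho : A -> H -> H) (rho_rep : unitary_rep B rho).
Context (x : H).

Let hull : set H := [set m | forall z c,
  (forall b, B b -> c <= rip (rho b x) z) -> c <= rip m z].

Let hull_orbit : hull x.
Proof.
have [B1 _ _] := gB; move=> z c /(_ _ B1).
by rewrite (rep1 gB rho_rep).
Qed.

Let hull_mid m m' : hull m -> hull m' -> hull ((2^-1)%:C *: (m + m')).
Proof.
move=> hm hm' z c zc; rewrite ripZl ripDl; have := hm _ _ zc; have := hm' _ _ zc.
by move: (rip m z) (rip m' z) => a b; lra.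
Qed.

Let hull_act b m : B b -> hull m -> hull (rho b m).
Proof.
move=> Bb hm z c zc; rewrite /rip (rep_adj gB rho_rep)//.
apply: hm => b' Bb'; have [_ BM _] := gB; have := zc _ (BM _ _ Bb Bb').
by rewrite (repM rho_rep)// /rip [in X in X -> _](rep_adj gB rho_rep).
Qed.

Let hull_limit v : (forall e : R, 0 < e -> exists2 m, hull m & nr (m - v) < e) -> hull v.
Proof.
move=> hv z c zc; rewrite leNgt; apply/negP => vc.
have z0 : 0 < nr z + 1 by rewrite ltr_wpDl// nr_ge0.
have [|m hm] := hv ((c - rip v z) / (nr z + 1)); first by rewrite divr_gt0// subr_gt0.
rewrite ltr_pdivlMr// => mv; have := hm _ _ zc.
have := le_trans (ler_norm _) (rip_CauchySchwarz (m - v) z); rewrite ripBl.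
have := nr_ge0 (m - v); nra.
Qed.

(** The midpoint of [m] and [m'] lies in the hull and has norm at least [d]. The parallelogram law
    then leaves 4 (d + e)^2 - 4 d^2 for the squared distance. *)
Let hull_close (d e : R) m m' : (forall m, hull m -> d <= nr m) -> 0 <= d -> 0 < e ->
  hull m -> hull m' -> nr m < d + e -> nr m' < d + e ->
  nr (m - m') ^+ 2 <= 8 * d * e + 4 * e ^+ 2.
Proof.
move=> dm d0 e0 hm hm' md m'd; rewrite parallelogram.
have := dm _ (hull_mid hm hm'); have := nr_ge0 m; have := nr_ge0 m'.
move: (nr m) (nr m') (nr (_ *: _)) md m'd => a b k ad bd b0 a0 dk.
have : a ^+ 2 <= (d + e) ^+ 2 by rewrite ler_pXn2r ?nnegrE ?addr_ge0 ?(ltW e0)// ltW.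
have : b ^+ 2 <= (d + e) ^+ 2 by rewrite ler_pXn2r ?nnegrE ?addr_ge0 ?(ltW e0)// ltW.
have : d ^+ 2 <= k ^+ 2 by rewrite ler_pXn2r ?nnegrE// (le_trans d0).
by rewrite sqrrD; lra.
Qed.

(* The vector of minimal norm in the closed convex hull of the orbit, the hull
   being the intersection of the half-spaces that contain the orbit. *)
Theorem invariant_vector : exists v,
  (forall b, B b -> rho b v = v) /\
  forall z c, (forall b, B b -> c <= rip (rho b x) z) -> c <= rip v z.
Proof.
pose N : set R := [set nr m | m in hull].
have N0 : N !=set0 by exists (nr x), x => //; exact: hull_orbit.
have Nlb : has_lbound N by exists 0 => _ [m _ <-]; exact: nr_ge0.
pose d := inf N.
have dm m : hull m -> d <= nr m by move=> hm; apply: ge_inf => //; exists m.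
have d0 : 0 <= d by apply: lb_le_inf => // _ [m _ <-]; exact: nr_ge0.
have dex e : 0 < e -> exists2 m, hull m & nr m < d + e.
  move=> e0; have [_ [m hm <-] me] := @inf_adherent _ N e e0 (conj N0 Nlb).
  by exists m.
have small e : 0 < e -> exists2 e', 0 < e' & 8 * d * e' + 4 * e' ^+ 2 < e ^+ 2.
  (* For [e' <= 1] the expression is at most (8 d + 4) e', which is less than (8 d + 8) e' and hence
     than [e ^+ 2] as soon as [e' <= q]. *)
  move=> e0; pose q := e ^+ 2 / (8 * d + 8).
  have q0 : 0 < q by rewrite divr_gt0 ?exprn_gt0//; lra.
  have qE : q * (8 * d + 8) = e ^+ 2 by rewrite /q divfK//; lra.
  exists (Num.min 1 q); first by rewrite lt_min ltr01.
  have : Num.min 1 q <= 1 by rewrite ge_min lexx.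
  have : Num.min 1 q <= q by rewrite ge_min lexx orbT.
  have : 0 < Num.min 1 q by rewrite lt_min ltr01.
  by move: (Num.min 1 q) => a; nra.
(* The almost minimal vectors of the hull form a filter, Cauchy by [hull_close]; its limit is the
   minimal vector. *)
pose F := filter_from [set e : R | 0 < e] (fun e => [set m | hull m /\ nr m < d + e]).
have FF : ProperFilter F.
  apply: filter_from_proper; last by move=> e /dex[m hm md]; exists m.
  apply: filter_from_filter; first by exists 1 => /=.
  move=> e e' e0 e'0; exists (Num.min e e'); first by rewrite /= lt_min; apply/andP.
  by move=> m [hm]; rewrite -ltrBlDl lt_min => /andP[]; rewrite !ltrBlDl.
have : cvg F.
  apply: cauchy_cvg; apply: cauchy_exP => e e0.
  have eE := ge0_ReK (ltW e0); have /small[e' e'0 ee'] : 0 < complex.Re e by rewrite -ltcR eE.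
  have [m hm md] := dex _ e'0; exists m; exists e' => // m' [hm' m'd].
  rewrite -ball_normE /= nrE -eE ltcR -(@ltr_pXn2r _ 2) ?nnegrE ?nr_ge0//; last first.
    by rewrite -lecR eE ltW.
  exact: le_lt_trans (hull_close dm d0 e'0 hm hm' md m'd) ee'.
move=> /cvg_ex[v Fcv].
have Fv e : 0 < e -> F [set m | nr (m - v) < e].
  move=> e0; apply: Fcv; apply/nbhs_ballP; exists e%:C; first by rewrite /= ltcR.
  by move=> m; rewrite -ball_normE /= nrE ltcR nrC.
have vm e e' : 0 < e -> 0 < e' -> exists m, [/\ hull m, nr m < d + e & nr (m - v) < e'].
  move=> e0 e'0; have Fe : F [set m | hull m /\ nr m < d + e] by exists e.
  by have [m [[hm md] mv]] := filter_ex (filterI Fe (Fv _ e'0)); exists m.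
have hv : hull v by apply: hull_limit => e e0; have [m [hm _ mv]] := vm 1 e ltr01 e0; exists m.
have vd : nr v <= d.
  apply/ler_addgt0Pr => e e0; have e2 : 0 < e / 2 by rewrite divr_gt0.
  have [m [hm md mv]] := vm _ _ e2 e2.
  by have := nr_tri2 v m; rewrite nrC; lra.
exists v; split=> // b Bb; apply/eqP; rewrite -subr_eq0; apply/eqP/nr0_eq0/eqP.
(* Both [rho b v] and [v] lie in the hull with norm at most [d], so [hull_close] applies to them for
   every [e] and excludes a positive distance. *)
rewrite eq_le nr_ge0 andbT leNgt; apply/negP => /small[e e0].
apply/negP; rewrite -leNgt; apply: hull_close => //; first exact: hull_act.
  by rewrite (rep_nr rho_rep)//; lra.
by lra.
Qed.

End InvariantVector.

(** * Bounding coefficients of [rho] by coefficients of invariant vectors *)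

Section CoefficientBound.
Context {R : realType} {A : preTopologicalGroupType} (G : set A) (gG : subgroup G).
Context {H T : hilbertType R} (rho : A -> H -> H) (tau : A -> T -> T).
Context (t : {bilinear H -> conj_space H -> T}).
Hypothesis rho_rep : unitary_rep G rho.
Hypothesis tauP : tensor_rep G t rho (conj_rep rho) tau.

(** The rank one tensor y (x) y^*. Inner products of such tensors are squared moduli, so they are
    nonnegative and summands may be dropped from lower bounds. *)
Definition tensor_sqr (y : H) : T := t y (y : conj_space H).

Lemma tensor_sqr_rip a y : rip (tensor_sqr a) (tensor_sqr y) = nr (inner a y) ^+ 2.
Proof.
have [[ti _] _ _] := tauP; rewrite /rip /tensor_sqr ti.
by rewrite -[inner (a : conj_space H) _]/(inner y a) (innerC y) -sqr_nr.
Qed.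

Lemma tensor_sqr_act g y : G g -> tau g (tensor_sqr y) = tensor_sqr (rho g y).
Proof. by move=> Gg; have [_ _ ->] := tauP. Qed.

Context (B : set A) (BG : B `<=` G).
Context (xi eta : H) (v v' : T).
Hypothesis vB : forall b, B b -> tau b v = v.
Hypothesis v'B : forall b, B b -> tau b v' = v'.
Hypothesis v_hull : forall z c,
  (forall b, B b -> c <= rip (tau b (tensor_sqr xi)) z) -> c <= rip v z.
Hypothesis v'_hull : forall z c,
  (forall b, B b -> c <= rip (tau b (tensor_sqr eta)) z) -> c <= rip v' z.
Context (e : R) (l l' : seq A).
Hypothesis lB : forall b, b \in l -> B b.
Hypothesis l'B : forall b, b \in l' -> B b.
Hypothesis l_net : forall b, B b -> exists2 a, a \in l & nr (rho b xi - rho a xi) <= e.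
Hypothesis l'_net : forall b, B b -> exists2 a, a \in l' & nr (rho b eta - rho a eta) <= e.

Let tau_rep : unitary_rep G tau. Proof. by have [] := tauP. Qed.

Lemma hull_tensor_ge0 y : 0 <= rip v (tensor_sqr y).
Proof.
apply: v_hull => b /BG Gb.
by rewrite tensor_sqr_act// tensor_sqr_rip sqr_ge0.
Qed.

(** Invariance of [v] turns the right side into a sum over the net [l]. For each [b] in [B], the net
    element nearest to [b] alone contributes at least [c ^+ 2] to the corresponding sum for the
    orbit point, and the hull property passes this bound to [v]. *)
Lemma hull_tensor_lower y c : 0 <= c -> e * nr y + c <= nr (inner xi y) ->
  c ^+ 2 <= (size l)%:R * rip v (tensor_sqr y).
Proof.
move=> c0 yc.
have -> : (size l)%:R * rip v (tensor_sqr y) =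
    rip v (\sum_(b <- l) tensor_sqr (rho b y)).
  rewrite rip_sumr (eq_big_seq (fun=> rip v (tensor_sqr y))).
    by rewrite big_const_seq count_predT iter_addr_0 mulr_natl.
  move=> b /lB Bb; rewrite -tensor_sqr_act//; last exact: BG.
  by rewrite -{1}(vB Bb) /rip (rep_inner tau_rep)//; exact: BG.
apply: v_hull => b Bb; have [a al ba] := l_net Bb.
have Ga := BG (lB al); have Gb := BG Bb.
rewrite tensor_sqr_act// rip_sumr (big_rem a)//= tensor_sqr_rip.
have : 0 <= \sum_(i <- rem a l) rip (tensor_sqr (rho b xi)) (tensor_sqr (rho i y)).
  by apply: sumr_ge0 => i _; rewrite tensor_sqr_rip sqr_ge0.
suff : c ^+ 2 <= nr (inner (rho b xi) (rho a y)) ^+ 2 by lra.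
rewrite ler_pXn2r ?nnegrE ?nr_ge0//.
have := nr_tri2 (inner (rho a xi) (rho a y)) (inner (rho b xi) (rho a y)).
rewrite -innerBl (rep_inner rho_rep)//.
have := inner_CauchySchwarz (rho a xi - rho b xi) (rho a y).
rewrite (rep_nr rho_rep)// (nrC (rho a xi)).
have := nr_ge0 y; have := nr_ge0 (rho b xi - rho a xi); nra.
Qed.

(** The averaging is done twice: over [l'] for [v'], at a cost of [e * nr xi], and then over [l]
    through [hull_tensor_lower], at a cost of [e * nr eta]. *)
Theorem coefficient_lower g c : G g -> 0 <= c ->
  e * (nr xi + nr eta) + c <= nr (inner (rho g xi) eta) ->
  c ^+ 2 <= (size l)%:R * (size l')%:R * rip (tau g v) v'.
Proof.
move=> Gg c0 gc; have [_ GM GV] := gG.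
have -> : (size l)%:R * (size l')%:R * rip (tau g v) v' =
    rip v' ((size l)%:R%:C *: \sum_(b <- l') tau b (tau g v)).
  rewrite ripZr rip_sumr (eq_big_seq (fun=> rip (tau g v) v')).
    by rewrite big_const_seq count_predT iter_addr_0 -[rip _ _ *+ _]mulr_natl mulrA.
  move=> b /l'B Bb; rewrite -{1}(v'B Bb) ripC /rip (rep_inner tau_rep)//.
  exact: BG.
apply: v'_hull => b Bb; have [a al ba] := l'_net Bb.
have Ga := BG (l'B al); have Gb := BG Bb.
have actE a' : a' \in l' -> rip (tau b (tensor_sqr eta)) (tau a' (tau g v)) =
    rip v (tensor_sqr (rho (a' * g)^-1%g (rho b eta))).
  move=> /l'B/BG Ga'; have Gag := GM _ _ Ga' Gg.
  rewrite -(repM tau_rep)// ripC /rip (rep_adj gG tau_rep)//.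
  by rewrite tensor_sqr_act// tensor_sqr_act//; exact: GV.
rewrite ripZr rip_sumr (eq_big_seq _ actE) (big_rem a)//=.
have Gag := GM _ _ Ga Gg.
have s0 : 0 <= \sum_(a' <- rem a l') rip v (tensor_sqr (rho (a' * g)^-1%g (rho b eta))).
  by apply: sumr_ge0 => i _; exact: hull_tensor_ge0.
rewrite mulrDr; apply: (@le_trans _ _
  ((size l)%:R * rip v (tensor_sqr (rho (a * g)^-1%g (rho b eta))))).
  apply: hull_tensor_lower => //.
  rewrite (rep_nr rho_rep); last exact: GV.
  rewrite (rep_nr rho_rep)// -(rep_adj gG rho_rep)// (repM rho_rep)//.
  have := nr_tri2 (inner (rho a (rho g xi)) (rho a eta))
    (inner (rho a (rho g xi)) (rho b eta)).
  rewrite -innerBr (rep_inner rho_rep)//.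
  have := inner_CauchySchwarz (rho a (rho g xi)) (rho a eta - rho b eta).
  rewrite !(rep_nr rho_rep)// (nrC (rho a eta)).
  have := nr_ge0 xi; have := nr_ge0 (rho b eta - rho a eta); nra.
by rewrite lerDl mulr_ge0.
Qed.

End CoefficientBound.

(** * Words, galleries and compact sets of automorphisms *)

Lemma finite_subsets (T : choiceType) (S : set T) :
  finite_set S -> finite_set [set J | J `<=` S].
Proof.
move=> /finite_seqP[s ->].
apply: (@sub_finite_set _ _ ((fun m : (size s).-tuple bool => [set` mask m s]) @` setT)).
  (* A subset of an enumerated set is cut out by a boolean mask, and there are finitely many
     masks. *)
  move=> J Js; exists [tuple of [seq `[< J x >] | x <- in_tuple s]] => //=.
  rewrite -filter_mask; apply/seteqP; split=> x /=; rewrite mem_filter.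
    by move=> /andP[/asboolP].
  by move=> Jx; rewrite Js// andbT; apply/asboolP.
exact/finite_image/finite_finset.
Qed.

Lemma finite_uniform (R : realType) (T : Type) (A : set T) (P : T -> R -> Prop) :
  finite_set A -> (forall a d d', 0 < d' -> d' <= d -> P a d -> P a d') ->
  (forall a, A a -> exists2 d, 0 < d & P a d) ->
  exists2 d, 0 < d & forall a, A a -> P a d.
Proof.
elim/Pchoice: T => T in A P *.
move=> /finite_seqP[s ->] mono; elim: s => [|a s IH] AP; first by exists 1.
have [|d d0 dP] := IH; first by move=> b bs; apply: AP; rewrite /= in_cons bs orbT.
have [d' d'0 d'P] := AP a (mem_head _ _).
exists (Num.min d d') => [|b]; first by rewrite lt_min d0.
rewrite /= in_cons => /orP[/eqP->|bs].
  by apply: mono d'P; rewrite ?lt_min ?d0// ge_min lexx orbT.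
by apply: mono (dP _ bs); rewrite ?lt_min ?d0// ge_min lexx.
Qed.

Section Words.
Context {W : groupType} (S : set W) (coxWS : coxeter_system S).
Implicit Types (w s : W) (u : seq W) (J : set W).

Definition wprod u : W := (\prod_(s <- u) s)%g.

Lemma wprod_cons s u : wprod (s :: u) = (s * wprod u)%g.
Proof. exact: big_cons. Qed.

Lemma wprod_cat u u' : wprod (u ++ u') = (wprod u * wprod u')%g.
Proof. exact: big_cat. Qed.

Lemma cox_invol s : S s -> (s * s = 1)%g.
Proof. by have [h _ _] := coxWS => /h[]. Qed.

Lemma cox_neq1 s : S s -> s <> 1%g.
Proof. by have [h _ _] := coxWS => /h[]. Qed.

Lemma cox_inv s : S s -> (s^-1 = s)%g.
Proof. by move=> /cox_invol ss; rewrite -[RHS]mulg1 -(mulgV s) mulgA ss mul1g. Qed.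

Lemma cox_mulK s w : S s -> (s * (s * w) = w)%g.
Proof. by move=> /cox_invol ss; rewrite mulgA ss mul1g. Qed.

Lemma wprod_rev u : (forall s, s \in u -> S s) -> wprod (rev u) = ((wprod u)^-1)%g.
Proof.
elim: u => [|s u IH] uS; first by rewrite /wprod !big_nil invg1.
rewrite rev_cons -cats1 wprod_cat [in RHS]wprod_cons invgM IH; last first.
  by move=> x xu; apply: uS; rewrite in_cons xu orbT.
by rewrite /wprod big_seq1 (@cox_inv s)//; exact: (uS _ (mem_head _ _)).
Qed.

(** The generators are involutions, so reversing a word inverts its product and the words in [J]
    already form a subgroup. *)
Lemma generated_word J w : J `<=` S -> generated J w ->
  exists2 u, (forall s, s \in u -> J s) & w = wprod u.
Proof.
move=> JS; suff : generated J `<=`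
  [set w | exists2 u, (forall s, s \in u -> J s) & w = wprod u].
  by apply.
apply: smallest_sub; last first.
  by move=> s Js; exists [:: s]; rewrite /wprod ?big_seq1// => x; rewrite inE => /eqP->.
split.
- by exists [::]; rewrite ?/wprod ?big_nil.
- move=> _ _ [u uJ ->] [u' u'J ->]; exists (u ++ u'); last by rewrite wprod_cat.
  by move=> s; rewrite mem_cat => /orP[/uJ|/u'J].
- move=> _ [u uJ ->]; exists (rev u); first by move=> s; rewrite mem_rev => /uJ.
  by rewrite wprod_rev// => s /uJ/JS.
Qed.

Lemma sub_generated J : J `<=` generated J.
Proof. exact: sub_smallest. Qed.

Lemma generated_subgroup J : subgroup (generated J).
Proof.
split=> [K [[K1 _ _] _]//|g h Jg Jh K KJ|g Jg K KJ]; have [[_ KM KV] _] := KJ.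
  by apply: KM; [exact: Jg|exact: Jh].
by apply: KV; exact: Jg.
Qed.

Lemma wprod_generated J u : (forall s, s \in u -> J s) -> generated J (wprod u).
Proof.
have [J1 JM _] := generated_subgroup J.
elim: u => [|s u IH] uJ; first by rewrite /wprod big_nil.
rewrite wprod_cons; apply: JM; first exact: (sub_generated (uJ _ (mem_head _ _))).
by apply: IH => x xu; apply: uJ; rewrite in_cons xu orbT.
Qed.

Lemma word_length_le u : (forall s, s \in u -> S s) -> (word_length S (wprod u) <= size u)%N.
Proof.
move=> uS; rewrite /word_length; case: pselect => // ex.
case: ex_minnP => n _; apply; apply/asboolP; by exists u.
Qed.

Lemma reduced_word w : exists u,
  [/\ size u = word_length S w, (forall s, s \in u -> S s) & w = wprod u].
Proof.
have [_ gS _] := coxWS; have : generated S w by rewrite gS.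
move=> /(generated_word (fun _ h => h))[u uS wu].
rewrite /word_length; case: pselect => [ex|[]]; last first.
  by exists (size u); apply/asboolP; exists u.
by case: ex_minnP => n /asboolP[u' [? ? ?]] _; exists u'.
Qed.

Definition reduced u := (forall s, s \in u -> S s) /\ word_length S (wprod u) = size u.

(** A shorter word for one of the factors would shorten the whole word. *)
Lemma reduced_cat u u' : reduced (u ++ u') -> reduced u /\ reduced u'.
Proof.
move=> [uS ul].
have u1S s : s \in u -> S s by move=> su; apply: uS; rewrite mem_cat su.
have u2S s : s \in u' -> S s by move=> su; apply: uS; rewrite mem_cat su orbT.
have [v [vl vS vE]] := reduced_word (wprod u).
have [v' [v'l v'S v'E]] := reduced_word (wprod u').
have := word_length_le u1S; have := word_length_le u2S.
have : (word_length S (wprod (u ++ u')) <= size (v ++ v'))%N.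
  rewrite wprod_cat vE v'E -wprod_cat; apply: word_length_le => s.
  by rewrite mem_cat => /orP[/vS|/v'S].
by rewrite ul !size_cat vl v'l => a b c; split; split=> //; lia.
Qed.

Lemma reduced_cons s u : reduced (s :: u) -> [/\ S s, reduced u &
  word_length S (s * wprod u)%g = (word_length S (wprod u)).+1].
Proof.
move=> ru; have [_ ru'] := @reduced_cat [:: s] u ru.
have [uS ul] := ru; have [_ ->] := ru'; rewrite -wprod_cons ul; split=> //.
exact: (uS _ (mem_head _ _)).
Qed.

Hypothesis finS : finite_set S.

Lemma minimal_non_spherical_sub J : J `<=` S -> ~ spherical J ->
  exists2 I, I `<=` J & minimal_non_spherical S I.
Proof.
move=> JS; have [s sE] : exists s : seq W, J = [set` s].
  exact/finite_seqP/(sub_finite_set JS).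
have [n] := ubnP (size s); elim: n s J JS sE => // n IH s J JS sE sn Jn.
have [min|] := pselect (forall I, I `<` J -> spherical I); first by exists J.
move=> /existsNP[I /not_implyP[[IJ nJI] nI]].
have IE : I = [set` [seq x <- s | `[< I x >]]].
  apply/seteqP; split=> x /=; rewrite mem_filter.
    by move=> Ix; apply/andP; split; [exact/asboolP|move/IJ: Ix; rewrite sE].
  by move=> /andP[/asboolP].
have [|K KI Kmin] := IH _ I (subset_trans IJ JS) IE _ nI; last first.
  by exists K => //; exact: subset_trans IJ.
(* The induction is on the length of a list for [J]. Filtering it by [I] drops an entry, since
   otherwise [J] would be contained in [I]. *)
rewrite -ltnS; apply: leq_trans sn; rewrite ltnS ltn_neqAle size_filter count_size andbT.
apply/eqP => /eqP; rewrite -all_count => /allP sI; apply: nJI => x.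
by rewrite sE /= => /sI/asboolP.
Qed.

(** [S] has finitely many spherical subsets, each generating a finite group, so the lengths of their
    elements are bounded; [N] is one more than the maximum. *)
Lemma long_words_non_spherical : exists N : nat, forall u, reduced u -> size u = N ->
  ~ spherical [set s | s \in u].
Proof.
pose U := \bigcup_(J in [set J | J `<=` S /\ spherical J]) generated J.
have finU : finite_set U.
  apply: bigcup_finite => [|J []//].
  by apply: sub_finite_set (finite_subsets finS) => J [].
have [l lU] := (finite_seqP U).1 finU.
exists (\max_(w <- l) word_length S w).+1 => u [uS ul] uN sph.
have : wprod u \in l.
  have : U (wprod u) by exists [set s | s \in u] => //; exact: wprod_generated.
  by rewrite lU.
move=> wl; have := @leq_bigmax_seq _ l predT (word_length S) _ wl isT.
by rewrite ul uN ltnn.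
Qed.

End Words.

(** * Panels, galleries and finite balls in a building *)

Section Building.
Context {W : groupType} (S : set W) (coxWS : coxeter_system S) (X : building S).
Implicit Types (C D : X) (s : W) (u : seq W).

Lemma wdistxx C : wdist C C = 1%g.
Proof. exact/wdist_eq1. Qed.

Lemma wdist_sym s C D : S s -> wdist C D = s -> wdist D C = s.
Proof.
move=> Ss CD; have := @wdist_adj _ _ X D C C s Ss CD.
rewrite wdistxx => -[s1|/esym/wdist_eq1 DC].
  by rewrite -[LHS](cox_mulK coxWS _ Ss) -s1 mulg1.
by move: CD; rewrite DC wdistxx => /esym/(cox_neq1 coxWS Ss).
Qed.

Lemma wdist_step s u C D : S s -> wdist C D = wprod (s :: u) ->
  exists C', wdist C' C = s /\ wdist C' D = wprod u.
Proof.
move=> Ss CD; have [C' [C'C C'D]] := wdist_ex C D Ss; exists C'; split=> //.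
by rewrite C'D CD wprod_cons (cox_mulK coxWS).
Qed.

(** Any word for the Weyl distance, reduced or not, is the type of a gallery from [C] to [D]; the
    triangle inequality is summed along it. *)
Lemma gallery_bound (R : realType) (E : normedZmodType R[i]) (f : X -> E) (J : set W) (e : R) :
  J `<=` S -> (forall s C D, J s -> wdist C D = s -> nr (f C - f D) <= e) ->
  forall u C D, (forall s, s \in u -> J s) -> wdist C D = wprod u ->
  nr (f C - f D) <= (size u)%:R * e.
Proof.
move=> JS fe; elim=> [|s u IH] C D uJ CD.
  have -> : C = D by apply/wdist_eq1; rewrite CD /wprod big_nil.
  by rewrite subrr nr0 mul0r.
have Js : J s := uJ _ (mem_head _ _).
have [C' [C'C C'D]] := wdist_step (JS _ Js) CD.
have := IH _ _ _ C'D; have := nr_tri (f C') (f C) (f D).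
have := fe _ _ _ Js C'C; rewrite nrC -[(size (s :: u))%:R]natr1.
by move=> h1 h2 h3; have := h3 (fun x xu => uJ x (mem_behead (s := s :: u) xu)); lra.
Qed.

Definition adj s C : set X := [set D | wdist D C = s].

Lemma adj_adj s C D D' : S s -> adj s C D -> adj s C D' -> D <> D' -> wdist D D' = s.
Proof.
move=> Ss DC D'C DD'; have := @wdist_adj _ _ X C D' D s Ss DC.
by rewrite (wdist_sym Ss D'C) (cox_invol coxWS Ss) => -[/wdist_eq1|].
Qed.

Lemma panelE s C : S s -> panel s C = [set C] `|` adj s C.
Proof.
move=> Ss; apply/seteqP; split=> D; last first.
  move=> [->|]; rewrite /panel /residue /= ?wdistxx.
    by have [] := generated_subgroup [set s].
  by move/(wdist_sym Ss) => ->; exact: sub_generated.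
move=> CD; have : [set 1%g; s] (wdist C D).
  apply: CD; split; last by move=> ? ->; right.
  split; first by left.
  - move=> ? ? [->|->] [->|->]; rewrite ?(mulg1, mul1g) ?(cox_invol coxWS Ss); by [left|right].
  - by move=> ? [->|->]; rewrite ?invg1 ?(cox_inv coxWS Ss); [left|right].
by move=> [/wdist_eq1->|/(wdist_sym Ss)]; [left|right].
Qed.

Hypothesis lfX : locally_finite X.

Lemma finite_adj s C : S s -> finite_set (adj s C).
Proof.
by move=> Ss; apply: sub_finite_set (lfX C Ss); rewrite panelE//; exact: subsetUr.
Qed.

Lemma adj_seq s C : thick X -> S s -> exists l : seq X,
  [/\ uniq l, (2 <= size l)%N & forall D, (D \in l) <-> adj s C D].
Proof.
move=> thX Ss; have [l0 l0E] := (finite_seqP _).1 (finite_adj C Ss).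
have lE D : (D \in undup l0) <-> adj s C D by rewrite mem_undup l0E.
exists (undup l0); split=> //; first exact: undup_uniq.
(* The panel consists of [C] and its neighbours, so three chambers in it leave at least two
   neighbours. *)
have := thX s C Ss; have -> : panel s C = [set` C :: undup l0].
  rewrite panelE//; apply/seteqP; split=> D /=; rewrite in_cons.
    by move=> [->|/lE->]; rewrite ?eqxx ?orbT.
  by move=> /orP[/eqP->|/lE]; [left|right].
set l := undup l0; have lI : ([set` C :: l] #<= `I_(size l).+1)%card.
  apply: card_le_trans (card_image_le (nth C (C :: l)) _).
  apply: subset_card_le => D /= /(nthP C)[k kl <-]; by exists k.
by move=> /card_le_trans/(_ lI); rewrite card_le_II.
Qed.

Hypothesis finS : finite_set S.

Definition wball (n : nat) C : set X :=
  [set D | exists u, [/\ size u = n, (forall s, s \in u -> S s) & wdist D C = wprod u]].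

Lemma finite_wball n C : finite_set (wball n C).
Proof.
elim: n => [|n IH].
  apply: sub_finite_set (finite_set1 C) => D [u [/size0nil-> _ DC]].
  by apply/wdist_eq1; rewrite DC /wprod big_nil.
apply: (@sub_finite_set _ _ (\bigcup_(E in wball n C) \bigcup_(s in S) adj s E)).
  move=> D [[|s u] [//= [su] uS DC]]; have Ss : S s := uS _ (mem_head _ _).
  have [E [ED EC]] := wdist_step Ss DC; exists E.
    by exists u; split=> // x xu; apply: uS; rewrite in_cons xu orbT.
  by exists s => //; exact: wdist_sym.
apply: bigcup_finite => // E _; apply: bigcup_finite => // s Ss.
exact: finite_adj.
Qed.

Lemma finite_sphere w C : finite_set [set D | wdist D C = w].
Proof.
have [u [_ uS ->]] := reduced_word coxWS w.
by apply: sub_finite_set (finite_wball (size u) C) => D DC; exists u.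
Qed.

Lemma finite_length_ball n C : finite_set [set D | (word_length S (wdist D C) < n)%N].
Proof.
apply: (@sub_finite_set _ _ (\bigcup_(k in `I_n) wball k C)).
  move=> D /= Dn; have [u [ul uS uE]] := reduced_word coxWS (wdist D C).
  by exists (size u); rewrite /= ?ul//; exists u; rewrite -ul.
by apply: bigcup_finite => [|k _]; [exact: finite_II|exact: finite_wball].
Qed.

End Building.

(** * Pointwise convergence and compactness for automorphisms *)

Section AutomTopology.
Context {W : groupType} (S : set W) (X : building S).
Local Notation autom := (autom X).

Lemma autom_eval_near (g : autom) (C : X) : nbhs g [set h : autom | h C = g C].
Proof.
have h : continuous (fun k : autom => (k : X -> X) : {ptws X -> discrete_topology X}).
  exact: initial_continuous.
have gC : nbhs (autom_fun g : {ptws X -> discrete_topology X}) [set k | k C = g C].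
  have c := @proj_continuous X (fun=> discrete_topology X) C (autom_fun g).
  apply: (c [set k | k = g C]); exact: (@discrete_set1 (discrete_topology X)).
exact: (h g _ gC).
Qed.

Lemma autom_cvg (F : set_system autom) (f : autom) : Filter F ->
  (forall C, F [set h : autom | h C = f C]) -> F --> f.
Proof.
move=> FF Ff A; rewrite nbhsE => -[U [[B oB <-] Bf] UA]; apply: filterS UA _.
pose D := discrete_topology X.
pose F' : set_system (D -> D) := (fun h : autom => (h : D -> D)) @ F.
suff : {ptws, F' --> (f : D -> D)} by apply; exact: open_nbhs_nbhs.
apply/pointwise_cvgP => C; apply/discrete_cvg; exact: Ff.
Qed.

(** Evaluation at [C] is continuous into a discrete space, where a compact set is covered by
    finitely many points. *)
Lemma compact_finite_orbit (Q : set autom) (C : X) :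
  compact Q -> finite_set [set g C | g in Q].
Proof.
move=> Qc.
pose D := discrete_topology X.
have : @compact D ((fun g : autom => g C : D) @` Q).
  apply: continuous_compact Qc; apply: continuous_subspaceT => g A /=.
  move=> /(nbhs_singleton) Ag; apply: filterS (autom_eval_near g C) => h /= hg.
  by rewrite /preimage /= hg.
pose D' : ptopologicalType := HB.pack D (isPointed.Build D C).
rewrite (@compact_cover D') => /(_ D [set g C | g in Q] (fun x => [set x])).
case=> [x _|x Qx|E EQ].
- exact: discrete_open.
- by exists x.
move=> sub; apply: sub_finite_set (finite_fset E) => x /sub[y /= yE ->].
exact: yE.
Qed.

End AutomTopology.

Lemma ultra_finite T (U : choiceType) (F : set_system T) (phi : T -> U) (E : set U) :
  UltraFilter F -> finite_set E -> F [set x | E (phi x)] ->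
  exists y, F [set x | phi x = y].
Proof.
move=> UF /finite_seqP[s ->]; elim: s => [|y s IH] Fs.
  by have [x] := filter_ex Fs.
have [|nFy] := in_ultra_setVsetC [set x | phi x = y] UF; first by exists y.
apply: IH; apply: filterS (filterI Fs nFy) => x [/=].
by rewrite in_cons => /orP[/eqP|].
Qed.

Section TypePreservingGroup.
Context {W : groupType} (S : set W) (coxWS : coxeter_system S) (finS : finite_set S).
Context (X : building S) (lfX : locally_finite X) (c0 : X).
Context (G : set (autom X)) (gG : subgroup G) (clG : closed G) (tpG : type_preserving G).

(** Along an ultrafilter on this set each [h C] is eventually constant, because [h C] keeps its Weyl
    distance to [h c0] and spheres are finite. The pointwise limit is an automorphism, and it lies
    in [G] because [G] is closed. *)
Theorem compact_orbit_finite (F0 : set X) : finite_set F0 ->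
  compact [set g | G g /\ F0 (g c0)].
Proof.
move=> finF0; rewrite compact_ultra => F UF FA.
have fin_image C : exists D, F [set h | h C = D].
  apply: (@ultra_finite _ _ _ (fun h : autom X => h C)
    (\bigcup_(e in F0) [set D | wdist D e = wdist C c0])).
    by apply: bigcup_finite => // e _; exact: finite_sphere.
  by apply: filterS FA => h [Gh hF]; exists (h c0) => //=; exact: tpG.
(* A pointwise limit of bijections can fail to be surjective, so the preimages are shown to
   stabilize as well. *)
have fin_preimage D : exists C, F [set h | h C = D].
  have hV (h : autom X) : h ((h^-1)%g D) = D.
    by have := mulgV h => /(congr1 (fun k : autom X => k D)).
  have finE : finite_set (\bigcup_(e in F0) [set C | wdist C c0 = wdist D e]).
    by apply: bigcup_finite => // e _; exact: finite_sphere.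
  have [|C FC] := @ultra_finite _ _ F (fun h : autom X => (h^-1)%g D) _ UF finE.
    apply: filterS FA => h [Gh hF]; exists (h c0) => //=.
    by rewrite -{2}(hV h) tpG.
  by exists C; apply: filterS FC => h /= <-.
have [f Ff] := choice fin_image; have [k Fk] := choice fin_preimage.
have kK : cancel k f.
  move=> D; have [h [/= h1 h2]] := filter_ex (filterI (Ff (k D)) (Fk D)).
  by rewrite -h1 h2.
have fK : cancel f k.
  move=> C; have [h [/= h1 h2]] := filter_ex (filterI (Ff C) (Fk (f C))).
  have [[h' hK _] _] := automP h; apply: (can_inj hK); by rewrite h1 h2.
have fW C D : wdist (f C) (f D) = wdist C D.
  have [h [/= [Gh _] [h1 h2]]] := filter_ex (filterI FA (filterI (Ff C) (Ff D))).
  by rewrite -h1 -h2 tpG.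
have fA : is_autom f.
  split; first by exists k.
  by exists id; split=> //; [exists id|rewrite image_id].
have Fp : F --> (Autom fA : autom X) by apply: autom_cvg => C; exact: Ff.
exists (Autom fA) => //; split=> //; split.
  apply: clG => V /Fp FV; have [h [[Gh _] Vh]] := filter_ex (filterI FA FV).
  by exists h.
by have [h [[_ /= hF] /= <-]] := filter_ex (filterI FA (Ff c0)).
Qed.

End TypePreservingGroup.

(** * Averaging over adjacent chambers *)

Section Averages.
Context {W : groupType} (S : set W) (coxWS : coxeter_system S) (finS : finite_set S).
Context (X : building S) (thX : thick X) (lfX : locally_finite X) (c0 : X).
Context (G : set (autom X)) (gG : subgroup G) (tpG : type_preserving G)
  (wtG : weyl_transitive G).
Context {R : realType} {T : hilbertType R} (tau : autom X -> T -> T).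
Hypothesis tau_rep : unitary_rep G tau.
Implicit Types (v : T) (C D : X) (s : W) (u : seq W).

Definition stabilizer : set (autom X) := [set g | G g /\ g c0 = c0].

Lemma stabilizer_sub : stabilizer `<=` G.
Proof. by move=> g []. Qed.

Lemma autom_injective (g : autom X) : injective g.
Proof. by have [[h gK _] _] := automP g; exact: can_inj gK. Qed.

Lemma autom_mulE (g h : autom X) C : (g * h)%g C = g (h C).
Proof. by []. Qed.

Lemma autom_invK (g : autom X) C : (g^-1)%g (g C) = C.
Proof. by have := mulVg g => /(congr1 (fun k : autom X => k C)). Qed.

Lemma stabilizer_subgroup : subgroup stabilizer.
Proof.
have [G1 GM GV] := gG; split=> [|g h [Gg gc] [Gh hc]|g [Gg gc]]; split=> //.
- exact: GM.
- by rewrite autom_mulE hc.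
- exact: GV.
- by rewrite -{1}gc autom_invK.
Qed.

Lemma transporter_ex C : exists g : autom X, G g /\ g c0 = C.
Proof. by have [g [Gg gC _]] := wtG (wdistxx c0) (wdistxx C); exists g. Qed.

Definition transporter C : autom X := proj1_sig (cid (transporter_ex C)).

Lemma transporterG C : G (transporter C).
Proof. by rewrite /transporter; case: cid => g []. Qed.

Lemma transporterE C : transporter C c0 = C.
Proof. by rewrite /transporter; case: cid => g []. Qed.

Definition invariant v := forall b, stabilizer b -> tau b v = v.

(* For an invariant [v] this does not depend on the choice of the transporter,
   and [at_chamber v (g c0) = tau g v]. *)
Definition at_chamber v C : T := tau (transporter C) v.

Lemma at_chamber_act v g C : invariant v -> G g ->
  tau g (at_chamber v C) = at_chamber v (g C).
Proof.
move=> vI Gg; have [_ GM GV] := gG; have GtC := transporterG C.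
have Gt := transporterG (g C).
rewrite /at_chamber -(repM tau_rep)//.
(* Both [transporter (g C)] and [g * transporter C] send [c0] to [g C], so they differ by an element
   that fixes [v]. *)
have /vI {2}<- : stabilizer ((transporter (g C))^-1 * (g * transporter C))%g.
  split; first exact: GM (GV _ Gt) (GM _ _ Gg GtC).
  have := autom_invK (transporter (g C)) c0.
  by rewrite !autom_mulE !transporterE.
rewrite -(repM tau_rep)//; last exact: GM (GV _ Gt) (GM _ _ Gg GtC).
by rewrite mulgA mulgV mul1g.
Qed.

Lemma at_chamber0 v : invariant v -> at_chamber v c0 = v.
Proof. by apply; split; [exact: transporterG|exact: transporterE]. Qed.

Lemma act_invariant v g : invariant v -> G g -> tau g v = at_chamber v (g c0).
Proof. by move=> vI Gg; rewrite -at_chamber_act// at_chamber0. Qed.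

Lemma nr_at_chamber v C : nr (at_chamber v C) = nr v.
Proof. exact: rep_nr tau_rep _ _ (transporterG C). Qed.

Lemma at_chamberB v v' C : at_chamber (v - v') C = at_chamber v C - at_chamber v' C.
Proof. exact: unitaryB (rep_unitary tau_rep (transporterG C)). Qed.

Lemma at_chamber_wdist v v' C D C' D' : invariant v -> invariant v' ->
  wdist C D = wdist C' D' -> exists2 g, G g &
  at_chamber v C' = tau g (at_chamber v C) /\ at_chamber v' D' = tau g (at_chamber v' D).
Proof.
move=> vI v'I CD; have [g [Gg gC gD]] := wtG (erefl (wdist C D)) (esym CD).
by exists g => //; rewrite !at_chamber_act// gC gD.
Qed.

Lemma rip_at_chamber v v' C D C' D' : invariant v -> invariant v' ->
  wdist C D = wdist C' D' ->
  rip (at_chamber v C) (at_chamber v' D) = rip (at_chamber v C') (at_chamber v' D').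
Proof.
move=> vI v'I /(at_chamber_wdist vI v'I)[g Gg [-> ->]].
by rewrite /rip (rep_inner tau_rep).
Qed.

Lemma dist_at_chamber v C D C' D' : invariant v -> wdist C D = wdist C' D' ->
  nr (at_chamber v C - at_chamber v D) = nr (at_chamber v C' - at_chamber v D').
Proof.
move=> vI /(at_chamber_wdist vI vI)[g Gg [-> ->]].
by rewrite -(unitaryB _ _ (rep_unitary tau_rep Gg)) (rep_nr tau_rep).
Qed.

Lemma neighbours_ex s : exists l : seq X, S s ->
  [/\ uniq l, (2 <= size l)%N & forall D, (D \in l) <-> adj s c0 D].
Proof.
have [/(adj_seq coxWS lfX c0 thX)[l lP]|nSs] := pselect (S s); first by exists l.
(* The empty list is the default value for [s] outside [S]. *)
by exists [::] => /nSs.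
Qed.

Definition neighbours s : seq X := proj1_sig (cid (neighbours_ex s)).

Lemma neighboursP s : S s -> [/\ uniq (neighbours s), (2 <= size (neighbours s))%N &
  forall D, (D \in neighbours s) <-> adj s c0 D].
Proof. by rewrite /neighbours; case: cid. Qed.

Local Notation nb s := (size (neighbours s)).

Definition average s v : T :=
  ((nb s)%:R^-1)%:C *: \sum_(D <- neighbours s) at_chamber v D.

Lemma average_invariant s v : S s -> invariant v -> invariant (average s v).
Proof.
move=> Ss vI b [Gb bc]; have [lu _ lE] := neighboursP Ss.
have bu := rep_unitary tau_rep Gb.
rewrite /average (unitaryZ _ _ bu) (unitary_sum _ _ bu); congr (_ *: _).
under eq_bigr do rewrite at_chamber_act//.
rewrite -(big_map b xpredT (at_chamber v)); apply: perm_big.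
have mu : uniq (map b (neighbours s)) by rewrite map_inj_uniq//; exact: autom_injective.
apply: uniq_perm => //.
(* An element of the stabilizer maps the neighbours injectively to neighbours, hence permutes the
   finite list. *)
apply: (uniq_min_size mu _ _).2; last by rewrite size_map.
move=> _ /mapP[D /lE DC ->]; apply/lE; rewrite /adj /=.
by rewrite -{1}bc tpG.
Qed.

Lemma at_chamber_average s v C : invariant v -> at_chamber (average s v) C =
  ((nb s)%:R^-1)%:C *: \sum_(D <- neighbours s) at_chamber v (transporter C D).
Proof.
move=> vI; have tu := rep_unitary tau_rep (transporterG C).
rewrite {1}/at_chamber /average (unitaryZ _ _ tu) (unitary_sum _ _ tu).
congr (_ *: _); apply: eq_bigr => D _; rewrite at_chamber_act//.
exact: transporterG.
Qed.

(** As the length goes up, every chamber [s]-adjacent to [C] has the same Weyl distance to [c0] as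
    [E]. All terms of the average therefore equal the one at [E]. *)
Lemma rip_average s v v' C E : S s -> invariant v -> invariant v' ->
  word_length S (s * wdist C c0)%g = (word_length S (wdist C c0)).+1 ->
  wdist E c0 = (s * wdist C c0)%g ->
  rip (at_chamber (average s v) C) v' = rip (at_chamber v E) v'.
Proof.
move=> Ss vI v'I sC EC; have [_ l2 lE] := neighboursP Ss.
rewrite at_chamber_average// ripZl rip_suml.
rewrite (eq_big_seq (fun=> rip (at_chamber v E) v')); last first.
  move=> D /lE Dc; rewrite -(at_chamber0 v'I); apply: rip_at_chamber => //.
  rewrite EC; apply: wdist_adj_up => //.
  by rewrite -{2}(transporterE C) tpG//; exact: transporterG.
rewrite big_const_seq count_predT iter_addr_0 -[rip _ _ *+ _]mulr_natl mulKf// pnatr_eq0.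
by rewrite -lt0n (leq_trans _ l2).
Qed.

Definition averages v u : T := foldl (fun x s => average s x) v u.

Lemma rip_averages v v' u E : invariant v -> invariant v' -> reduced S u ->
  wdist E c0 = wprod u -> rip (at_chamber v E) v' = rip (averages v u) v'.
Proof.
move=> + v'I; elim: u v E => [|s u IH] v E vI.
  by move=> _; rewrite /wprod big_nil => /wdist_eq1->; rewrite at_chamber0.
move=> /(reduced_cons coxWS)[Ss ru sl] Ec.
have [C [CE Cc]] := wdist_step coxWS Ss Ec.
rewrite -(@rip_average s v v' C E) ?Cc ?Ec ?wprod_cons//.
by rewrite (IH (average s v))//; exact: average_invariant.
Qed.

(** Distinct neighbours of [c0] in a panel are [s]-adjacent to each other. The Gram matrix of the
    averaged vectors thus has |v|^2 on the diagonal and one constant off it. *)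
Lemma average_gram s v D : S s -> invariant v -> adj s c0 D ->
  (nb s)%:R * nr (average s v) ^+ 2 =
  nr v ^+ 2 + ((nb s)%:R - 1) * rip (at_chamber v D) v.
Proof.
move=> Ss vI DC; have [lu l2 lE] := neighboursP Ss.
have q0 : (nb s)%:R != 0 :> R by rewrite pnatr_eq0 -lt0n (leq_trans _ l2).
set b := rip (at_chamber v D) v.
have off E E' : E \in neighbours s -> E' \in neighbours s -> E <> E' ->
    rip (at_chamber v E) (at_chamber v E') = b.
  move=> /lE Ec /lE E'c EE'.
  have -> : b = rip (at_chamber v D) (at_chamber v c0) by rewrite at_chamber0.
  apply: rip_at_chamber => //.
  by rewrite DC; apply: (adj_adj coxWS) Ec E'c EE'.
have row E : E \in neighbours s ->
    \sum_(E' <- neighbours s) rip (at_chamber v E) (at_chamber v E') =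
    nr v ^+ 2 + ((nb s)%:R - 1) * b.
  move=> El; rewrite (big_rem E)//= rip_nr nr_at_chamber; congr (_ + _).
  rewrite (eq_big_seq (fun=> b)); last first.
    move=> E'; rewrite mem_rem_uniq// inE => /andP[EE' E'l].
    by apply: off => // EE; rewrite EE eqxx in EE'.
  rewrite big_const_seq count_predT iter_addr_0 size_rem// -[b *+ _]mulr_natl -subn1.
  by rewrite natrB// (leq_trans _ l2).
rewrite -rip_nr /average ripZl ripZr rip_suml.
rewrite (eq_big_seq (fun=> nr v ^+ 2 + ((nb s)%:R - 1) * b)); last first.
  by move=> E El; rewrite rip_sumr row.
rewrite big_const_seq count_predT iter_addr_0 -[(_ + _) *+ _]mulr_natl.
by field.
Qed.

(** With [q] neighbours, [average_gram] gives |v_D - v|^2 = 2 q / (q - 1) times the defect, and q >=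
    2 bounds this factor by 4. *)
Lemma average_defect s v D : S s -> invariant v -> adj s c0 D ->
  nr (at_chamber v D - v) ^+ 2 <= 4 * (nr v ^+ 2 - nr (average s v) ^+ 2).
Proof.
move=> Ss vI DC; have := average_gram Ss vI DC.
have [_ l2 _] := neighboursP Ss.
have : (2 : R) <= (nb s)%:R by rewrite ler_nat.
rewrite nrB_sqr nr_at_chamber.
have : rip (at_chamber v D) v <= nr v ^+ 2.
  apply: le_trans (ler_norm _) (le_trans (rip_CauchySchwarz _ _) _).
  by rewrite nr_at_chamber expr2.
move: (rip _ _) (nr v ^+ 2) (nr (average _ _) ^+ 2) ((nb s)%:R) => b N A q; nra.
Qed.

Lemma average_le s v : S s -> invariant v -> nr (average s v) ^+ 2 <= nr v ^+ 2.
Proof.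
move=> Ss vI; have [_ l2 lE] := neighboursP Ss.
case: (neighbours s) l2 lE => // D l _ lE.
have := average_defect Ss vI ((lE D).1 (mem_head _ _)).
by have := sqr_ge0 (nr (at_chamber v D - v)); lra.
Qed.

Lemma averages_le u v : (forall s, s \in u -> S s) -> invariant v ->
  nr (averages v u) ^+ 2 <= nr v ^+ 2 /\ invariant (averages v u).
Proof.
elim: u v => [|s u IH] v uS vI; first by [].
have Ss : S s := uS _ (mem_head _ _).
have [|le inv] := IH _ _ (average_invariant Ss vI).
  by move=> x xu; apply: uS; rewrite in_cons xu orbT.
by split=> //; exact: le_trans le (average_le Ss vI).
Qed.

Lemma average_close s v (h : R) : S s -> 
  (forall D, adj s c0 D -> nr (at_chamber v D - v) <= h) -> nr (average s v - v) <= h.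
Proof.
move=> Ss vh; have [_ l2 lE] := neighboursP Ss.
have q0 : 0 < (nb s)%:R :> R by rewrite ltr0n (leq_trans _ l2).
have -> : average s v - v =
    ((nb s)%:R^-1)%:C *: \sum_(D <- neighbours s) (at_chamber v D - v).
  rewrite sumrB scalerBr; congr (_ - _).
  rewrite big_const_seq count_predT iter_addr_0 -[v *+ _]scaler_nat scalerA.
  by rewrite -(rmorph_nat (real_complex R)) -rmorphM mulVf ?gt_eqF// rmorph1 scale1r.
rewrite nrZ nr_real ger0_norm ?invr_ge0 ?ler0n// ler_pdivrMl//.
have nr_sum (l : seq X) : nr (\sum_(D <- l) (at_chamber v D - v)) <=
    \sum_(D <- l) nr (at_chamber v D - v).
  elim: l => [|D l IH]; first by rewrite !big_nil nr0.
  by rewrite !big_cons; apply: le_trans (nrD _ _) _; rewrite lerD2l.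
apply: le_trans (nr_sum _) _.
rewrite mulr_natl -iter_addr_0 -[nb s](count_predT (neighbours s)) -big_const_seq.
by rewrite big_seq [leRHS]big_seq; apply: ler_sum => D /lE; exact: vh.
Qed.

(** The total defect is a sum of nonnegative defects, one per letter, so each averaging moves its
    vector by at most [h]. Carrying an estimate from the averaged vector back to [v] costs [h] at
    [D] and [h] at [c0], which explains the factor 2 per letter. *)
Lemma averages_close u v (h : R) : (forall s, s \in u -> S s) -> invariant v ->
  0 <= h -> 4 * (nr v ^+ 2 - nr (averages v u) ^+ 2) <= h ^+ 2 ->
  forall s D, s \in u -> adj s c0 D ->
  nr (at_chamber v D - v) <= (2 * (size u)%:R + 1) * h.
Proof.
elim: u v => [//|s u IH] v uS vI h0 vh s' D s'u DC.
have Ss : S s := uS _ (mem_head _ _).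
have uS' x : x \in u -> S x by move=> xu; apply: uS; rewrite in_cons xu orbT.
have aI := average_invariant Ss vI.
have [ale _] := averages_le uS' aI.
have head_close E : adj s c0 E -> nr (at_chamber v E - v) <= h.
  move=> Ec; rewrite -(@ler_pXn2r _ 2) ?nnegrE ?nr_ge0//.
  by apply: le_trans (average_defect Ss vI Ec) _; move: vh ale => /=; lra.
have vle := average_le Ss vI.
have sz : (size (s :: u))%:R = (size u)%:R + 1 :> R by rewrite -natr1.
have su0 : 0 <= (size u)%:R :> R by [].
move: s'u; rewrite in_cons => /orP[/eqP s's|s'u].
  by rewrite s's in DC; apply: le_trans (head_close _ DC) _; rewrite sz; nra.
have := IH (average s v) uS' aI h0 _ s' D s'u DC.
have ac := average_close Ss head_close.
have := nr_tri (at_chamber (average s v) D) (at_chamber v D) v.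
have := nr_tri (average s v) (at_chamber (average s v) D) v.
rewrite -at_chamberB nr_at_chamber (nrC v) sz => h1 h2 h3.
have : 4 * (nr (average s v) ^+ 2 - nr (averages (average s v) u) ^+ 2) <= h ^+ 2.
  by move: vh => /=; lra.
by move=> /h3; nra.
Qed.

(** * Uniform contraction along reduced words and decay of coefficients *)

Section Decay.
Context (d : R) (d0 : 0 < d) (d1 : d <= 1).
Hypothesis gap : forall v J, invariant v -> minimal_non_spherical S J ->
  (forall s D, J s -> adj s c0 D -> nr (at_chamber v D - v) <= d * nr v) -> v = 0.

Lemma averages_contract : exists (N : nat) (r : R), [/\ 0 <= r, r < 1 &
  forall u v, reduced S u -> size u = N -> invariant v ->
  nr (averages v u) ^+ 2 <= r * nr v ^+ 2].
Proof.
have [N NP] := long_words_non_spherical finS.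
have m0 : 0 < 2 * N%:R + 1 :> R by rewrite ltr_wpDl// mulr_ge0.
have m1 : 1 <= 2 * N%:R + 1 :> R by rewrite lerDr mulr_ge0.
(* If the contraction by 1 - f^2 / 4 fails for [v], then [averages_close] with [h = f |v|] bounds
   every displacement by [d |v|], and the gap forces [v = 0]. *)
pose f := d / (2 * N%:R + 1).
have f0 : 0 < f by rewrite divr_gt0.
have f1 : f <= 1 by rewrite ler_pdivrMr// mul1r (le_trans d1).
have fE : (2 * N%:R + 1) * f = d by rewrite /f mulrC divfK ?gt_eqF.
exists N, (1 - f ^+ 2 / 4); split; [by nra|by rewrite gtrBl divr_gt0// exprn_gt0|].
move=> u v ru uN vI; rewrite leNgt; apply/negP => vu.
have uS : forall s, s \in u -> S s by case: ru.
have [J Ju Jmin] :=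
  minimal_non_spherical_sub finS (uS : [set s | s \in u] `<=` S) (NP _ ru uN).
have v0 : v = 0.
  apply: gap Jmin _ => // s D Js Dc.
  have := @averages_close u v (f * nr v) uS vI _ _ s D (Ju _ Js) Dc.
  rewrite uN mulrA fE; apply.
    by rewrite mulr_ge0 ?nr_ge0 ?ltW.
  by rewrite exprMn; move: vu; lra.
have [] := averages_le uS vI; rewrite v0 nr0 expr0n /= => le _.
by move: vu; rewrite v0 nr0 expr0n /= mulr0; lra.
Qed.

Theorem rip_decay v v' : invariant v -> invariant v' -> forall e : R, 0 < e ->
  exists M : nat, forall D, (M <= word_length S (wdist D c0))%N ->
  rip (at_chamber v D) v' < e.
Proof.
move=> vI v'I e e0.
have [N [r [r0 r1 rP]]] := averages_contract.
(* The word is cut into [k] blocks of length [N]; each block is again reduced and contracts by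
   [r]. *)
have iter k u x : reduced S u -> (k * N <= size u)%N -> invariant x ->
    nr (averages x u) ^+ 2 <= r ^+ k * nr x ^+ 2.
  elim: k u x => [|k IH] u x ru uN xI.
    by rewrite expr0 mul1r; apply: (averages_le _ xI).1; case: ru.
  have Nu : size (take N u) = N by rewrite size_takel// (leq_trans _ uN)// leq_pmull.
  move: ru; rewrite -(cat_take_drop N u) => /(reduced_cat coxWS)[rt rd].
  have [_ tI] := averages_le rt.1 xI.
  rewrite /averages foldl_cat; apply: le_trans (IH _ _ rd _ tI) _.
    by rewrite size_drop leq_subRL -?mulSn// -Nu size_take_min geq_minr.
  by rewrite (exprSr r k) -mulrA ler_wpM2l ?exprn_ge0// rP.
have [k kP] : exists k, r ^+ k * (nr v ^+ 2 * nr v' ^+ 2) < e ^+ 2.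
  have m0 : 0 < nr v ^+ 2 * nr v' ^+ 2 + 1 by rewrite ltr_wpDl// mulr_ge0 ?sqr_ge0.
  have : r ^+ k @[k --> \oo] --> (0 : R) by apply: cvg_expr; rewrite ger0_norm.
  move=> /cvgrPdist_lt/(_ (e ^+ 2 / (nr v ^+ 2 * nr v' ^+ 2 + 1))).
  rewrite divr_gt0 ?exprn_gt0// => /(_ isT)[k _ /(_ k (leqnn k))] /=.
  rewrite sub0r normrN ger0_norm ?exprn_ge0// ltr_pdivlMr// => rk; exists k.
  by apply: le_lt_trans rk; rewrite ler_wpM2l ?exprn_ge0// lerDl.
exists (k * N)%N => D DN; have [u [ul uS uE]] := reduced_word coxWS (wdist D c0).
have ru : reduced S u by split=> //; rewrite -uE.
rewrite (rip_averages vI v'I ru uE).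
apply: le_lt_trans (le_trans (ler_norm _) (rip_CauchySchwarz _ _)) _.
rewrite -(@ltr_pXn2r _ 2) ?nnegrE ?mulr_ge0 ?nr_ge0 ?ltW// exprMn.
apply: le_lt_trans kP; rewrite mulrA ler_wpM2r ?sqr_ge0//.
by apply: iter => //; rewrite ul.
Qed.

End Decay.
End Averages.

(** * The spectral gap and the dichotomy *)

Section Gap.
Context {W : groupType} (S : set W) (coxWS : coxeter_system S) (finS : finite_set S).
Context (X : building S) (thX : thick X) (lfX : locally_finite X) (c0 : X).
Context (G : set (autom X)) (gG : subgroup G) (tpG : type_preserving G)
  (wtG : weyl_transitive G).
Context {R : realType} {H T : hilbertType R}.
Context (rho : autom X -> H -> H) (tau : autom X -> T -> T).
Context (t : {bilinear H -> conj_space H -> T}).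
Hypothesis tauP : tensor_rep G t rho (conj_rep rho) tau.

Let tau_rep : unitary_rep G tau. Proof. by have [] := tauP. Qed.

Local Notation at_chamber := (at_chamber c0 wtG tau).

Lemma parabolic_sub J : parabolic G c0 J `<=` G.
Proof. by move=> g []. Qed.

Lemma parabolic_wdist J g : parabolic G c0 J g -> generated J (wdist c0 (g c0)).
Proof.
move=> [_ gJ]; have : residue J c0 (g c0); last by [].
rewrite -gJ; exists c0 => //; rewrite /residue /= wdistxx.
by have [] := generated_subgroup J.
Qed.

(** Non-amenability supplies a compact set [Q] and an error on which weak containment fails. The
    orbit of [c0] under [Q] is finite, so its chambers are reached from [c0] by galleries in [J] of
    bounded length; a nonzero vector hardly moved by single letters is hardly moved by [Q] and would
    witness the containment. *)
Lemma non_amenable_gap J : minimal_non_spherical S J ->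
  ~ bekka_amenable (parabolic G c0 J) rho ->
  exists2 d : R, 0 < d & forall v, invariant c0 G tau v ->
  (forall s D, J s -> adj s c0 D -> nr (at_chamber v D - v) <= d * nr v) -> v = 0.
Proof.
move=> [JS _ _] nam.
have tauJ : tensor_rep (parabolic G c0 J) t rho (conj_rep rho) tau.
  have [tT _ tt] := tauP; split=> //; first exact: unitary_rep_sub (@parabolic_sub J) tau_rep.
  by move=> g x y /parabolic_sub; exact: tt.
have : ~ weakly_contained (parabolic G c0 J) (@trivial_rep R (autom X)) tau.
  by move=> wc; apply: nam; exists T, t, tau.
move=> /existsNP[x /existsNP[Q /existsNP[e /not_implyP[QJ /not_implyP[Qc]]]]].
move=> /not_implyP[e0 nwc].
have [l lE] := (finite_seqP _).1 (compact_finite_orbit c0 Qc).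
have word D : D \in l -> exists u, (forall s, s \in u -> J s) /\ wdist c0 D = wprod u.
  move=> Dl; have [g Qg <-] : [set g c0 | g in Q] D by rewrite lE.
  by have [u uJ uE] := generated_word coxWS JS (parabolic_wdist (QJ _ Qg)); exists u.
have [M MP] : exists M : nat, forall D, D \in l -> exists u,
    [/\ forall s, s \in u -> J s, wdist c0 D = wprod u & (size u <= M)%N].
  elim: (l) word => [|D l' IH] word; first by exists 0%N.
  have [|M MP] := IH; first by move=> E El; apply: word; rewrite in_cons El orbT.
  have [u [uJ uE]] := word D (mem_head _ _).
  exists (maxn M (size u)) => E; rewrite in_cons => /orP[/eqP->|/MP[u' [u'J u'E u'M]]].
    by exists u; rewrite leq_maxr.
  by exists u'; split=> //; rewrite leq_max u'M.
have eE := ge0_ReK (ltW e0); set e' := complex.Re e in eE.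
have e'0 : 0 < e' by rewrite -ltcR eE.
have x0 : 0 < nr x ^+ 2 + 1 by rewrite ltr_wpDl// sqr_ge0.
have M0 : 0 < M%:R + 1 :> R by rewrite ltr_wpDl.
(* The final error is at most [M d |x|^2]; adding 1 to each factor makes the divisors positive and
   the last inequality strict. *)
exists (e' / (M%:R + 1) / (nr x ^+ 2 + 1)) => [|v vI vd]; first by rewrite !divr_gt0.
set d := e' / _ / _ in vd.
have d0 : 0 <= d by rewrite !divr_ge0 ?ltW.
have dE : (M%:R + 1) * d * (nr x ^+ 2 + 1) = e'.
  by rewrite /d; field; rewrite !gt_eqF.
apply: contrapT => vn0; apply: nwc.
have nv : 0 < nr v by rewrite lt_def nr_ge0 andbT; apply/eqP => /nr0_eq0.
have close g : Q g -> nr (v - tau g v) <= M%:R * (d * nr v).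
  move=> Qg; have Gg := parabolic_sub (QJ _ Qg).
  have : g c0 \in l by have : [set` l] (g c0) by rewrite -lE; exists g.
  move=> /MP[u [uJ uE uM]].
  rewrite (act_invariant gG wtG tau_rep vI Gg) -{1}(at_chamber0 wtG vI).
  apply: le_trans (_ : (size u)%:R * (d * nr v) <= _); last first.
    by rewrite ler_wpM2r ?ler_nat// mulr_ge0// nr_ge0.
  apply: (gallery_bound coxWS JS _ uJ uE) => s C D Js CD.
  have [D' [D's _]] := wdist_ex c0 c0 (JS _ Js).
  rewrite (dist_at_chamber gG wtG tau_rep vI (etrans CD (esym D's))).
  by rewrite (at_chamber0 wtG vI); exact: vd Js D's.
(* Scaled so that |y| = |x|, which makes the coefficient of the trivial representation equal to <y,
   y>. *)
pose y : T := (x * ((nr v)^-1)%:C) *: v.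
exists [:: y] => g Qg; rewrite big_seq1.
have Gg := parabolic_sub (QJ _ Qg).
have xx : inner (trivial_rep (R := R) g x) x = inner y y.
  rewrite -[LHS]/(x * conjC x) inner_nr /y nrZ nrM nr_real ger0_norm ?invr_ge0 ?ltW//.
  by rewrite divfK ?gt_eqF// sqr_nr.
rewrite xx -innerBl nrE -eE ltcR.
apply: le_lt_trans (inner_CauchySchwarz _ _) _.
have ty : tau g y = (x * ((nr v)^-1)%:C) *: tau g v.
  exact: unitaryZ (rep_unitary tau_rep Gg).
rewrite ty /y -scalerBr !nrZ nrM nr_real ger0_norm ?invr_ge0 ?ltW//.
rewrite [X in _ * X](_ : _ = nr x); last by rewrite -mulrA mulVf ?mulr1// gt_eqF.
have h : (nr v)^-1 * nr (v - tau g v) <= M%:R * d.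
  by rewrite ler_pdivrMl// mulrC -mulrA; exact: close.
have -> : nr x * (nr v)^-1 * nr (v - tau g v) * nr x =
    nr x ^+ 2 * ((nr v)^-1 * nr (v - tau g v)) by ring.
apply: le_lt_trans (ler_wpM2l (sqr_ge0 _) h) _; rewrite -dE.
have d1 : 0 < d by rewrite !divr_gt0.
by have := sqr_ge0 (nr x); have : 0 <= M%:R :> R by []; nra.
Qed.

End Gap.

Lemma compact_net (R : realType) (A : preTopologicalGroupType) (G B : set A)
    (H : hilbertType R) (rho : A -> H -> H) (x : H) (e : R) :
  unitary_rep G rho -> B `<=` G -> compact B -> 0 < e ->
  exists l : seq A, (forall a, a \in l -> B a) /\
    forall b, B b -> exists2 a, a \in l & nr (rho b x - rho a x) <= e.
Proof.
move=> rho_rep BG Bc e0; have [_ _ /(_ x) rc] := unitary_rep_sub BG rho_rep.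
have : compact ((fun g => rho g x) @` B) by exact: continuous_compact rc Bc.
rewrite compact_cover => /(_ A B (fun b => ball (rho b x) e%:C)).
case=> [b _|_ [b Bb <-]|D DB cov].
- exact: ball_open.
- by exists b => //; apply: ballxx; rewrite ltcR.
exists (enum_fset D); split=> [a aD|b Bb]; first exact/set_mem/DB.
have [|a aD] := cov (rho b x); first by exists b.
by rewrite -ball_normE /= nrE ltcR nrC => /ltW; exists a.
Qed.

Theorem theorem1 (R : realType) (W : groupType) (S : set W)
    (coxWS : coxeter_system S) (finS : finite_set S)
    (X : building S) (thickX : thick X) (lfX : locally_finite X) (c0 : X)
    (G : set (autom X)) (gG : subgroup G) (clG : closed G)
    (tpG : type_preserving G) (wtG : weyl_transitive G)
    (H : hilbertType R) (rho : autom X -> H -> H) (rho_rep : unitary_rep G rho) :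
  mixing G rho \/
  exists J : set W, minimal_non_spherical S J /\
                    bekka_amenable (parabolic G c0 J) rho.
Proof.
have [am|nam] := pselect (exists J : set W, minimal_non_spherical S J /\
  bekka_amenable (parabolic G c0 J) rho); [by right|left].
have [T [t [tau tauP]]] := tensor_rep_exists gG rho_rep (conj_rep_unitary rho_rep).
have tau_rep : unitary_rep G tau by have [] := tauP.
pose inv := invariant c0 G tau.
have [d [d0 d1 gap]] : exists d : R, [/\ 0 < d, d <= 1 &
    forall v J, inv v -> minimal_non_spherical S J ->
    (forall s D, J s -> adj s c0 D ->
      nr (at_chamber c0 wtG tau v D - v) <= d * nr v) -> v = 0].
  have [||d d0 dP] := @finite_uniform R _ [set J | J `<=` S] (fun J d =>
      minimal_non_spherical S J -> forall v, inv v ->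
      (forall s D, J s -> adj s c0 D ->
        nr (at_chamber c0 wtG tau v D - v) <= d * nr v) -> v = 0) (finite_subsets finS).
  - move=> J d d' _ d'd gap Jmin v vI vd; apply: gap => // s D Js Dc.
    by apply: le_trans (vd _ _ Js Dc) _; rewrite ler_wpM2r// nr_ge0.
  - move=> J _; have [Jmin|nJ] := pselect (minimal_non_spherical S J); last by exists 1.
    have namJ : ~ bekka_amenable (parabolic G c0 J) rho by move=> am; apply: nam; exists J.
    have [d d0 dP] := non_amenable_gap coxWS gG wtG tauP Jmin namJ.
    by exists d.
  (* One gap now serves all subsets of [S]; the minimum with 1 supplies the bound [d <= 1] used for
     the contraction rate. *)
  exists (Num.min d 1); split; [by rewrite lt_min d0 ltr01|by rewrite ge_min lexx orbT|].
  move=> v J vI Jmin vd; have [JS _ _] := Jmin; apply: (dP J JS Jmin v vI) => s D Js Dc.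
  apply: le_trans (vd _ _ Js Dc) _; rewrite ler_wpM2r ?nr_ge0//.
  by rewrite ge_min lexx.
have compB : compact (stabilizer c0 G).
  have := compact_orbit_finite coxWS finS lfX (c0 := c0) clG tpG (finite_set1 c0).
  exact.
have BG := @stabilizer_sub _ _ X c0 G.
have gB := stabilizer_subgroup c0 gG.
have tauB := unitary_rep_sub BG tau_rep.
move=> x y e e0; have eE := ge0_ReK (ltW e0); set r := complex.Re e in eE.
have r0 : 0 < r by rewrite -ltcR eE.
have [v [vI v_hull]] := invariant_vector gB tauB (tensor_sqr t x).
have [v' [v'I v'_hull]] := invariant_vector gB tauB (tensor_sqr t y).
have xy0 : 0 < nr x + nr y + 1 by rewrite ltr_wpDl// addr_ge0 ?nr_ge0.
(* With nets of this mesh the two approximation errors together use at most half of [r], and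
   [c = r / 2] remains in [coefficient_lower]. *)
pose f := r / 2 / (nr x + nr y + 1).
have f0 : 0 < f by rewrite !divr_gt0.
have fE : f * (nr x + nr y) <= r / 2.
  rewrite /f -mulrA ger_pMr ?divr_gt0// mulrC ler_pdivrMr// mul1r.
  by rewrite lerDl.
have [l [lB l_net]] := compact_net x rho_rep BG compB f0.
have [l' [l'B l'_net]] := compact_net y rho_rep BG compB f0.
have n0 : 0 < (size l)%:R * (size l')%:R + 1 :> R by rewrite ltr_wpDl// mulr_ge0.
have k0 : 0 < (r / 2) ^+ 2 / ((size l)%:R * (size l')%:R + 1).
  by rewrite divr_gt0// exprn_gt0// divr_gt0.
have [M MP] := rip_decay coxWS finS thickX lfX gG tpG tau_rep d0 d1 gap vI v'I k0.
(* This set is compact because balls of chambers are finite. Outside it, the decay bound from [MP]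
   contradicts [coefficient_lower]. *)
exists [set g | G g /\ (word_length S (wdist (g c0) c0) < M)%N]; split.
- by move=> g [].
- have := compact_orbit_finite coxWS finS lfX (c0 := c0) clG tpG
    (finite_length_ball coxWS lfX finS M c0).
  exact.
move=> g Gg gM; rewrite nrE -eE ltcR ltNge; apply/negP => rg.
have /MP : (M <= word_length S (wdist (g c0) c0))%N.
  by rewrite leqNgt; apply/negP => gM'; apply: gM.
rewrite ltr_pdivlMr// -(act_invariant gG wtG tau_rep vI Gg) => small.
have r2 : 0 <= r / 2 by rewrite divr_ge0 ?ltW.
have rg' : f * (nr x + nr y) + r / 2 <= nr (inner (rho g x) y).
  by apply: le_trans rg; move: fE; lra.
have low := coefficient_lower gG rho_rep tauP BG vI v'I v_hull v'_hull
  lB l'B l_net l'_net Gg r2 rg'.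
(* A negative coefficient makes the right side of [low] at most 0; for a nonnegative one, [small]
   keeps it below (r / 2)^2. *)
have : 0 <= rip (tau g v) v' \/ rip (tau g v) v' < 0 by case: leP => h; [left|right].
have : 0 < (r / 2) ^+ 2 by rewrite exprn_gt0// divr_gt0.
have : 0 <= (size l)%:R * (size l')%:R :> R by rewrite mulr_ge0.
by move: small low; move: (rip _ _) ((size l)%:R * (size l')%:R) => p n ? ? ? ? [?|?]; nra.
Qed.
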